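(* Let $K$ be the operator with finitely many bounded separated interactions described in the context, with associated quantities $p,r,\zeta,C$ and $R_N$. Then $K$ is Hilbert--Schmidt. For every integer $N\ge0$ there is an operator $K_N$ of rank at most $R_N$ such that $$\|K-K_N\|\le\|K-K_N\|_{\mathrm{HS}}\le C\frac{\zeta^N}{N!},$$ where for $N=0$ the right-hand side is understood as $C$, including when $\zeta=0$. Consequently, $$s_{R_N+1}(K)\le C\frac{\zeta^N}{N!}.$$ If, in addition, $\|K\|\le1$, $S:=K^*K$, and $0<\epsilon<1/2$, define $$N_{\mathrm{an}}(\epsilon):=\min\left\{N\in\mathbb N_0:\ C\frac{\zeta^N}{N!}\le\sqrt\epsilon\right\}$$ (the admissible set is nonempty because $\zeta^N/N!\to0$). Then $$\Lambda_\epsilon(S)\le p\binom{N_{\mathrm{an}}(\epsilon)+r-1}{r},$$ where the binomial coefficient is interpreted as zero when $N_{\mathrm{an}}(\epsilon)=0$.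
   Context: Let $(X,\mu)$ and $(Y,\nu)$ be $\sigma$-finite measure spaces and $p,r\ge1$ integers. Let $w_X,a_1,\dots,a_p$ be measurable functions on $X$ and $w_Y,b_1,\dots,b_p$ measurable functions on $Y$ with $w_Xa_q\in L^2(X)$, $w_Yb_q\in L^2(Y)$ for $1\le q\le p$, and set $\mathfrak a(x,y):=\sum_{q=1}^pa_q(x)b_q(y)$. Let $\phi:X\to\mathbb R$, $\psi:Y\to\mathbb R$, $X_\ell:X\to\mathbb R$, $Y_\ell:Y\to\mathbb R$ ($1\le\ell\le r$) be measurable, and put $$\Phi(x,y)=\phi(x)+\psi(y)+\sum_{\ell=1}^rX_\ell(x)Y_\ell(y),$$ $$(Kf)(y)=w_Y(y)\int_Xw_X(x)\,\mathfrak a(x,y)\exp\!\left(i\Phi(x,y)\right)f(x)\,d\mu(x),\qquad f\in L^2(X).$$ Choose real centers $\xi_\ell,\eta_\ell$ and put $R_\ell:=\operatorname{ess\,sup}_{x\in X}|X_\ell(x)-\xi_\ell|$, $S_\ell:=\operatorname{ess\,sup}_{y\in Y}|Y_\ell(y)-\eta_\ell|$; these radii are assumed finite. Set $$\zeta:=\sum_{\ell=1}^rR_\ell S_\ell,\qquad C:=\left\|w_X(x)w_Y(y)\mathfrak a(x,y)\right\|_{L^2(X\times Y)}<\infty.$$ For $N\ge1$ (in the integer-indexed notation for ranks, distinct from the radii $R_\ell$), $R_N:=p\binom{N+r-1}{r}$, and for $N=0$ the rank bound is $R_0:=0$. $s_1\ge s_2\ge\cdots$ are singular values, and $\Lambda_\epsilon(S):=\operatorname{rank}\mathbf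 1_{(\epsilon,1-\epsilon)}(S)$ for a positive contraction $S$. *)

(* Defs.v *)
From HB Require Import structures.
From mathcomp Require Import all_boot all_order all_algebra.
From mathcomp Require Import all_classical all_reals all_analysis.
From mathcomp Require Import measurable_realfun ess_sup_inf complex.

Set Implicit Arguments.
Unset Strict Implicit.
Unset Printing Implicit Defensive.

Import Order.TTheory GRing.Theory Num.Theory.
Import numFieldNormedType.Exports.

Local Open Scope classical_set_scope.
Local Open Scope ring_scope.
Local Open Scope complex_scope.

Section complex_functions.
Context d (T : measurableType d) (R : realType).

Definition cmod (z : R[i]) : R := ComplexField.Normc.normc z.

Definition expi (t : R) : R[i] := cos t +i* sin t.

Definition cmeasurable (f : T -> R[i]) : Prop :=
  measurable_fun setT (fun x => complex.Re (f x)) /\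
  measurable_fun setT (fun x => complex.Im (f x)).

Definition cintegral (mu : {measure set T -> \bar R}) (f : T -> R[i]) : R[i] :=
  (\int[mu]_x complex.Re (f x)) +i* (\int[mu]_x complex.Im (f x)).

Definition L2norm (mu : {measure set T -> \bar R}) (f : T -> R[i]) : \bar R :=
  Lnorm mu 2%:E (fun x => (cmod (f x))%:E).

Definition sqint (mu : {measure set T -> \bar R}) : {pred T -> R[i]} :=
  mem [set f | cmeasurable f /\ (L2norm mu f < +oo)%E].

End complex_functions.

Section L2.
Context d (T : measurableType d) (R : realType).
Variable mu : {measure set T -> \bar R}.

Lemma cmod_ge0 (z : R[i]) : 0 <= cmod z.
Proof. by case: z => a b; exact: sqrtr_ge0. Qed.

Lemma cmodD (z w : R[i]) : cmod (z + w) <= cmod z + cmod w.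
Proof.
have /= := ler_normD z w.
by rewrite lecE /= => /andP[].
Qed.

Lemma cmodM (z w : R[i]) : cmod (z * w) = cmod z * cmod w.
Proof. exact: ComplexField.Normc.normcM. Qed.

Lemma measurable_cmod (f : T -> R[i]) :
  cmeasurable f -> measurable_fun setT (fun x => cmod (f x)).
Proof.
move=> [mr mi].
have -> : (fun x => cmod (f x)) =
    (fun x => Num.sqrt (complex.Re (f x) ^+ 2 + complex.Im (f x) ^+ 2)).
  by apply/funext => x; rewrite /cmod; case: (f x).
apply: (measurableT_comp (measurable_funTS _)) => /=; last first.
  by apply: measurable_funD; exact: measurable_funX.
by apply: continuous_measurable_fun; exact: sqrt_continuous.
Qed.

Lemma cmeasurableD (f g : T -> R[i]) :
  cmeasurable f -> cmeasurable g -> cmeasurable (f + g).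
Proof.
move=> [fr fi] [gr gi]; split.
- rewrite (_ : (fun _ => _) = (fun x => complex.Re (f x) + complex.Re (g x))).
    exact: measurable_funD.
  by apply/funext => x; rewrite /GRing.add/=; case: (f x) (g x) => [? ?] [].
- rewrite (_ : (fun _ => _) = (fun x => complex.Im (f x) + complex.Im (g x))).
    exact: measurable_funD.
  by apply/funext => x; rewrite /GRing.add/=; case: (f x) (g x) => [? ?] [].
Qed.

Lemma cmeasurableZ (c : R[i]) (f : T -> R[i]) :
  cmeasurable f -> cmeasurable (c *: f).
Proof.
move=> [fr fi]; case: c => a b; split.
- rewrite (_ : (fun _ => _) =
      (fun x => a * complex.Re (f x) - b * complex.Im (f x))).
    by apply: measurable_funB; apply: measurable_funM.
  by apply/funext => x; rewrite /GRing.scale/=; case: (f x).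
- rewrite (_ : (fun _ => _) =
      (fun x => a * complex.Im (f x) + b * complex.Re (f x))).
    by apply: measurable_funD; apply: measurable_funM.
  by apply/funext => x; rewrite /GRing.scale/=; case: (f x).
Qed.

Lemma L2norm_lty (f : T -> R[i]) :
  (L2norm mu f < +oo)%E <-> (\int[mu]_x ((cmod (f x)) ^+ 2)%:E < +oo)%E.
Proof.
rewrite /L2norm unlock.
have -> : (\int[mu]_x (`|(cmod (f x))%:E| `^ 2) =
           \int[mu]_x ((cmod (f x)) ^+ 2)%:E)%E.
  apply: eq_integral => x _.
  by rewrite abse_EFin poweR_EFin ger0_norm ?cmod_ge0// powR_mulrn ?cmod_ge0.
split=> h; last exact: poweR_lty.
by apply: lty_poweRy h; rewrite invr_neq0.
Qed.

Lemma sqint_submod_closed : submod_closed (@sqint _ T R mu).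
Proof.
split.
  rewrite inE; split.
    by split; exact: measurable_cst.
  apply/L2norm_lty.
  rewrite integral0_eq// => x _.
  by rewrite [cmod _](_ : _ = 0) ?expr0n//; exact: ComplexField.Normc.normc0.
move=> c f g; rewrite !inE => -[mf lf] [mg lg].
have mcf := cmeasurableZ c mf.
split; first exact: cmeasurableD.
have lcf : (L2norm mu (c *: f) < +oo)%E.
  apply/L2norm_lty; move/L2norm_lty: lf => lf.
  under eq_integral do rewrite cmodM exprMn EFinM.
  rewrite ge0_integralZl//.
  - by rewrite lte_mul_pinfty// lee_fin exprn_ge0// cmod_ge0.
  - by apply/measurable_EFinP/measurable_funX; exact: measurable_cmod.
  - by move=> x _; rewrite lee_fin exprn_ge0// cmod_ge0.
  - by rewrite lee_fin exprn_ge0// cmod_ge0.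
set h := c *: f in lcf mcf *.
have mm := measurable_cmod.
apply: (@le_lt_trans _ _ (Lnorm mu 2%:E (fun x => (cmod (h x) + cmod (g x))%:E))).
  rewrite /L2norm unlock gt0_ler_poweR//.
  - by rewrite in_itv/= leey andbT integral_ge0// => x _; exact: poweR_ge0.
  - by rewrite in_itv/= leey andbT integral_ge0// => x _; exact: poweR_ge0.
  have mpow (u : T -> R) : measurable_fun setT u ->
      measurable_fun setT (fun x => (`|(u x)%:E| `^ 2)%E).
    move=> mu'; apply/measurable_EFinP.
    apply: (measurableT_comp (measurable_powR _)) => //.
    exact: measurableT_comp.
  apply: ge0_le_integral => //.
  - by move=> x _; exact: poweR_ge0.
  - exact: (mpow _ (mm _ (cmeasurableD mcf mg))).
  - apply: (mpow (fun x => cmod (h x) + cmod (g x))).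
    by apply: measurable_funD; apply: mm.
  - move=> x _ /=; rewrite lee_fin ge0_ler_powR ?nnegrE//.
    rewrite !ger0_norm ?addr_ge0 ?cmod_ge0//.
    exact: cmodD.
apply: (@le_lt_trans _ _ (L2norm mu h + L2norm mu g)%E).
  have h2 : (1 <= 2%:E :> \bar R)%E by rewrite lee_fin ler1n.
  exact: (@eminkowski _ _ _ mu (fun x => cmod (h x)) (fun x => cmod (g x))
    2%:E (mm _ mcf) (mm _ mg) h2).
by rewrite lte_add_pinfty.
Qed.

HB.instance Definition _ :=
  GRing.isSubmodClosed.Build _ _ (@sqint _ T R mu) sqint_submod_closed.

Record L2fun := MkL2fun { L2fun_val :> T -> R[i];
                          L2fun_sqint : L2fun_val \in @sqint _ T R mu }.
HB.instance Definition _ := [isSub for L2fun_val].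
HB.instance Definition _ := [Choice of L2fun by <:].
HB.instance Definition _ := [SubChoice_isSubLmodule of L2fun by <:].

Lemma L2funB (f g : L2fun) x : (f - g) x = f x - g x.
Proof. by []. Qed.

Lemma L2funZ (c : R[i]) (f : L2fun) x : (c *: f) x = c * f x.
Proof. by []. Qed.

Definition L2null : {pred L2fun} :=
  mem [set f : L2fun | {ae mu, forall x, f x = 0}].

Lemma L2null_zmod_closed : zmod_closed L2null.
Proof.
split; first by rewrite inE; apply/nearW.
move=> f g; rewrite !inE => f0 g0.
near=> x.
have fx : f x = 0 by near: x.
have gx : g x = 0 by near: x.
by rewrite L2funB fx gx subrr.
Unshelve. all: by end_near. Qed.

HB.instance Definition _ :=
  GRing.isZmodClosed.Build _ L2null L2null_zmod_closed.

Definition L2 := Quotient.quot L2null.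
HB.instance Definition _ := GRing.Zmodule.on L2.
HB.instance Definition _ := EqQuotient.on L2.

Local Open Scope quotient_scope.

Definition L2_scale (c : R[i]) (f : L2) : L2 := \pi_L2 (c *: repr f).

Lemma L2_eqP (f g : L2fun) :
  \pi_L2 f = \pi_L2 g <-> {ae mu, forall x, f x = g x}.
Proof.
have -> : (\pi_L2 f = \pi_L2 g) <-> f - g \in L2null.
  by split=> [/eqP|h]; [|apply/eqP]; rewrite -Quotient.idealrBE.
rewrite inE; split; apply: filterS => x.
  by rewrite L2funB => h; apply/eqP; rewrite -subr_eq0 h.
by move=> h; rewrite L2funB h subrr.
Qed.

Lemma repr_pi_ae (f : L2fun) :
  {ae mu, forall x, repr (\pi_L2 f) x = f x}.
Proof. by apply/L2_eqP; rewrite reprK. Qed.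

Lemma L2_scale_pi (c : R[i]) (f : L2fun) :
  L2_scale c (\pi_L2 f) = \pi_L2 (c *: f).
Proof.
apply/L2_eqP; apply: filterS (repr_pi_ae f) => x h.
by rewrite !L2funZ h.
Qed.

Lemma L2_piD (f g : L2fun) : \pi_L2 (f + g) = \pi_L2 f + \pi_L2 g.
Proof. exact: (@Quotient.pi_add _ L2null). Qed.

Lemma L2_scaleA a b v : L2_scale a (L2_scale b v) = L2_scale (a * b) v.
Proof.
by elim/quotW: v => f; rewrite (L2_scale_pi b) !L2_scale_pi scalerA.
Qed.

Lemma L2_scale1 : left_id 1 L2_scale.
Proof. by elim/quotW => f; rewrite L2_scale_pi scale1r. Qed.

Lemma L2_scaleDr : right_distributive L2_scale +%R.
Proof.
move=> a; elim/quotW => f; elim/quotW => g.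
by rewrite -L2_piD !L2_scale_pi scalerDr L2_piD.
Qed.

Lemma L2_scaleDl v : {morph L2_scale^~ v : a b / a + b}.
Proof.
by elim/quotW: v => f a b; rewrite !L2_scale_pi scalerDl L2_piD.
Qed.

HB.instance Definition _ := GRing.Zmodule_isLmodule.Build R[i] L2
  L2_scaleA L2_scale1 L2_scaleDr L2_scaleDl.

Definition L2_to_fun (f : L2) : T -> R[i] := repr f.
Coercion L2_to_fun : L2 >-> Funclass.

(* Independent of the representatives chosen by [repr]. *)
Definition dot (f g : L2) : R[i] := cintegral mu (fun x => f x * conjc (g x)).

Definition norm2 (f : L2) : \bar R := L2norm mu f.

Definition orthonormal_family n (e : 'I_n -> L2) : Prop :=
  forall i j, dot (e i) (e j) = (i == j)%:R.

Definition orthonormal_basis (B : set L2) : Prop :=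
  (forall e f, B e -> B f -> dot e f = (e == f)%:R) /\
  (forall (f : L2) (eps : R), 0 < eps ->
     exists n (e : 'I_n -> L2) (c : 'I_n -> R[i]),
       (forall i, B (e i)) /\
       (norm2 (f - \sum_(i < n) c i *: e i)%R < eps%:E)%E).

End L2.

Definition lin_indep (F : pzRingType) (V : lmodType F) n (v : 'I_n -> V) :=
  forall c : 'I_n -> F, \sum_(i < n) c i *: v i = 0 -> forall i, c i = 0.

Section operators.
Context d1 d2 (X : measurableType d1) (Y : measurableType d2) (R : realType).
Variables (mu : {measure set X -> \bar R}) (nu : {measure set Y -> \bar R}).
Local Open Scope ereal_scope.
Implicit Types T : L2 mu -> L2 nu.

Definition opnorm T : \bar R :=
  ereal_sup [set norm2 (T f) | f in [set f | norm2 f <= 1]].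

Definition hs_norm (B : set (L2 mu)) T : \bar R :=
  (\esum_(e in B) norm2 (T e) ^+ 2) `^ (2^-1)%R.

(* Every L^2 space has an orthonormal basis (not necessarily countable), and
   for bounded T the value [hs_norm B T] does not depend on the basis B. *)
Definition hilbert_schmidt T : Prop :=
  opnorm T < +oo /\
  forall B, orthonormal_basis B -> hs_norm B T < +oo.

(* The dimension of the range of a linear operator, possibly infinite. *)
Definition op_rank T : \bar R :=
  ereal_sup [set n%:R%:E | n in
    [set n | exists v : 'I_n -> L2 mu, lin_indep (fun i => T (v i))]].

Definition is_adjoint T (A : L2 nu -> L2 mu) : Prop :=
  forall f g, dot (T f) g = dot f (A g).

(* Unique when it exists, which is the case for every bounded operator. *)
Definition adjoint T : L2 nu -> L2 mu := xget (fun=> 0%R) (is_adjoint T).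

End operators.

(* The n-th largest (n >= 1) eigenvalue of (T^* T)^(1/2), counted with
   multiplicity: the largest l such that n orthonormal eigenvectors of T^* T
   have eigenvalues s_i ^ 2 with s_i >= l, and 0 if there is no such l > 0. *)
Definition singular_value d1 d2 (X : measurableType d1)
    (Y : measurableType d2) (R : realType)
    (mu : {measure set X -> \bar R}) (nu : {measure set Y -> \bar R})
    (T : L2 mu -> L2 nu) (n : nat) : \bar R :=
  ereal_sup ([set 0%E] `|` [set l%:E | l in
    [set l : R | 0 < l /\
      exists (e : 'I_n -> L2 mu) (s : 'I_n -> R), orthonormal_family e /\
        forall i, l <= s i /\ adjoint T (T (e i)) = (s i ^+ 2)%:C *: e i]]).

Section spectral.
Context d (X : measurableType d) (R : realType).
Variable mu : {measure set X -> \bar R}.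
Implicit Types (S : L2 mu -> L2 mu) (E : set R -> L2 mu -> L2 mu).

(* A projection-valued measure E with S = \int t dE(t). Countable additivity
   is carried by the measures m(B) = |E(B) f|^2 = <E(B) f, f>. *)
Definition is_spectral_measure S E : Prop :=
  [/\ forall f, E setT f = f,
      forall A B f, measurable A -> measurable B ->
        E (A `&` B) f = E A (E B f),
      forall B f g, measurable B -> dot (E B f) g = dot f (E B g) &
      forall f, exists m : {measure set R -> \bar R},
        [/\ forall B, measurable B -> m B = (norm2 (E B f) ^+ 2)%E,
            m.-integrable setT (fun t => t%:E) &
            dot (S f) f = (\int[m]_t t)%:C]].

(* For bounded self-adjoint S the spectral theorem provides a spectral measure
   of S, unique on measurable sets: E(B) is then 1_B(S). *)
Definition spectral_projection S : set R -> L2 mu -> L2 mu :=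
  xget (fun _ _ => 0) (is_spectral_measure S).

Definition Lambda (eps : R) S : \bar R :=
  op_rank (spectral_projection S `]eps, (1 - eps)[).

End spectral.

Definition rank_bound (p r N : nat) : nat :=
  if N is 0 then 0%N else (p * 'C(N + r - 1, r))%N.

Definition is_least (P : nat -> Prop) (N : nat) : Prop :=
  P N /\ forall M, P M -> (N <= M)%N.

Section separated_kernel.
Context d1 d2 (X : measurableType d1) (Y : measurableType d2) (R : realType).
Variable mu : {measure set X -> \bar R}.

Definition amplitude p (a : 'I_p -> X -> R[i]) (b : 'I_p -> Y -> R[i])
    (x : X) (y : Y) : R[i] := \sum_(q < p) a q x * b q y.

Definition phase r (phi : X -> R) (psi : Y -> R)
    (Xl : 'I_r -> X -> R) (Yl : 'I_r -> Y -> R) (x : X) (y : Y) : R :=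
  phi x + psi y + \sum_(l < r) Xl l x * Yl l y.

Definition oscillatory_integral (wX : X -> R[i]) (wY : Y -> R[i])
    (amp : X -> Y -> R[i]) (Phi : X -> Y -> R) (f : X -> R[i]) (y : Y) : R[i] :=
  wY y * cintegral mu (fun x => wX x * amp x y * expi (Phi x y) * f x).

End separated_kernel.

(* [fine] gives 0 on a null space, where the library's [ess_sup] is -oo. *)
Definition ess_radius d (X : measurableType d) (R : realType)
    (mu : {measure set X -> \bar R}) (u : X -> R) (c : R) : R :=
  fine (ess_sup mu (fun x => `|u x - c|%:E)).

(* Main.v *)
(* Recentering gives Phi = phi'(x) + psi'(y) + u(x,y), where
   u = sum_l (X_l - xi_l)(Y_l - eta_l) satisfies |u| <= zeta almost everywhere.
   Replacing exp(iu) by its Taylor polynomial of degree < N costs at most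
   |u|^N / N! pointwise, hence C zeta^N / N! in L^2 of the product. Expanding the
   powers of u, the truncated kernel is a combination of functions of x times
   w_Y b_q exp(i psi') prod_l (Y_l - eta_l)^(alpha_l) with |alpha| < N, and there
   are p * 'C(N + r - 1, r) of these. Applying Bessel's inequality to the
   sections k(., y) and integrating in y bounds the Hilbert-Schmidt norm of an
   integral operator by the L^2 norm of its kernel, for any orthonormal basis.
   For the spectral statements, a space of dimension > rank K_N meets the
   kernel of K_N, where |K g| = |(K - K_N) g| <= C zeta^N / N! |g|. *)

Require Import Defs.
From HB Require Import structures.
From mathcomp Require Import all_boot all_order all_algebra.
From mathcomp Require Import all_classical all_reals all_analysis.
From mathcomp Require Import measurable_realfun ess_sup_inf complex.
From mathcomp Require Import ring lra.

Set Implicit Arguments.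
Unset Strict Implicit.
Unset Printing Implicit Defensive.

Import Order.TTheory GRing.Theory Num.Theory.
Import numFieldNormedType.Exports.

Local Open Scope classical_set_scope.
Local Open Scope ring_scope.
Local Open Scope complex_scope.

(** Elements of [L2] are classes read through chosen representatives, so pointwise identities hold
    only almost everywhere, and the sections of a square integrable kernel lie in L^2 only for
    almost every y. Operators are therefore built from kernels by pairing with sections: at each
    good y the value is an inner product in [L2 mu], and linearity, Bessel's inequality and the
    splitting of a kernel become facts about [dot]. The error of the approximation is itself the
    operator of a square integrable kernel, which lets one Hilbert-Schmidt estimate serve K and
    every K - K_N. Passing from there to the operator norm has to work for a basis of any
    cardinality, known only through approximation by finite combinations. The rank is controlled by
    the functions of y alone: powers of u are expanded over words in r letters, and words with the
    same letter counts share one function of y, so no multinomial coefficients appear. *)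

(** * Moduli, conjugates and unimodular phases *)

Section complex_modulus.
Variable R : realType.
Implicit Types z w : R[i].

Lemma complexReM z w : complex.Re (z * w) =
  complex.Re z * complex.Re w - complex.Im z * complex.Im w.
Proof. by case: z w => ? ? []. Qed.

Lemma complexImM z w : complex.Im (z * w) =
  complex.Re z * complex.Im w + complex.Im z * complex.Re w.
Proof. by case: z w => ? ? []. Qed.

Lemma complexReD z w : complex.Re (z + w) = complex.Re z + complex.Re w.
Proof. by case: z w => ? ? []. Qed.

Lemma complexImD z w : complex.Im (z + w) = complex.Im z + complex.Im w.
Proof. by case: z w => ? ? []. Qed.

Lemma complexRe_mulr z (x : R) : complex.Re (z * x%:C) = complex.Re z * x.
Proof. by rewrite complexReM /= mulr0 subr0. Qed.

Lemma complexReN z : complex.Re (- z) = - complex.Re z.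
Proof. by case: z. Qed.

Lemma complexRe_sum (I : Type) (s : seq I) (P : pred I) (F : I -> R[i]) :
  complex.Re (\sum_(i <- s | P i) F i) = \sum_(i <- s | P i) complex.Re (F i).
Proof. by elim/big_rec2: _ => [|i x z _ <-]; rewrite ?complexReD. Qed.

Lemma complexRe_conj z : complex.Re (conjc z) = complex.Re z.
Proof. by case: z. Qed.

Lemma complexIm_conj z : complex.Im (conjc z) = - complex.Im z.
Proof. by case: z. Qed.

Lemma real_complexM (s t : R) : (s * t)%:C = s%:C * t%:C.
Proof. exact: rmorphM. Qed.

Lemma conjcD z w : conjc (z + w) = conjc z + conjc w.
Proof. exact: rmorphD. Qed.

Lemma conjcM z w : conjc (z * w) = conjc z * conjc w.
Proof. exact: rmorphM. Qed.

Lemma conjcB z w : conjc (z - w) = conjc z - conjc w.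
Proof. exact: rmorphB. Qed.

Lemma conjcX z n : conjc (z ^+ n) = conjc z ^+ n.
Proof. exact: rmorphXn. Qed.

Lemma conjc_sum (I : Type) (s : seq I) (P : pred I) (F : I -> R[i]) :
  conjc (\sum_(i <- s | P i) F i) = \sum_(i <- s | P i) conjc (F i).
Proof. exact: rmorph_sum. Qed.

Lemma conjcN1 : conjc (-1 : R[i]) = -1.
Proof. by rewrite rmorphN1. Qed.

Lemma complex_eqP z w :
  complex.Re z = complex.Re w -> complex.Im z = complex.Im w -> z = w.
Proof. by case: z w => ? ? [] ? ? /= -> ->. Qed.

Lemma sqr_cmod z : cmod z ^+ 2 = complex.Re z ^+ 2 + complex.Im z ^+ 2.
Proof. by case: z => x y; rewrite sqr_sqrtr ?addr_ge0 ?sqr_ge0. Qed.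

Lemma mulc_conj z : z * conjc z = (cmod z ^+ 2)%:C.
Proof.
by rewrite sqr_cmod; case: z => x y; apply: complex_eqP => /=; ring.
Qed.

Lemma cmod_conj z : cmod (conjc z) = cmod z.
Proof. by case: z => x y; rewrite /cmod/= sqrrN. Qed.

Lemma cmod_expi (t : R) : cmod (expi t) = 1.
Proof. by rewrite /cmod/expi/= cos2Dsin2 sqrtr1. Qed.

Lemma cmod0 : cmod 0 = 0 :> R.
Proof. exact: ComplexField.Normc.normc0. Qed.

Lemma cmodN z : cmod (- z) = cmod z.
Proof. by case: z => x y; rewrite /cmod/= !sqrrN. Qed.

Lemma cmod1 : cmod 1 = 1 :> R.
Proof. exact: ComplexField.Normc.normc1. Qed.

Lemma cmod_eq0 z : cmod z = 0 -> z = 0.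
Proof. exact: ComplexField.Normc.eq0_normc. Qed.

Lemma cmod_real (x : R) : cmod x%:C = `|x|.
Proof. by rewrite /cmod/= expr0n addr0 sqrtr_sqr. Qed.

Lemma cmodX z n : cmod (z ^+ n) = cmod z ^+ n.
Proof.
by elim: n => [|n IH]; rewrite ?expr0 ?cmod1// !exprS cmodM IH.
Qed.

Lemma ler_Re_cmod z : complex.Re z <= cmod z.
Proof.
have [z0|z0] := lerP 0 (complex.Re z); last first.
  by apply: le_trans (ltW z0) (cmod_ge0 z).
by rewrite -(@ler_pXn2r _ 2)// ?nnegrE ?cmod_ge0// sqr_cmod lerDl sqr_ge0.
Qed.

Lemma expiD (s t : R) : expi (s + t) = expi s * expi t.
Proof. by apply: complex_eqP; rewrite /= ?cosD ?sinD; ring. Qed.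

End complex_modulus.

(** * Measurable, integrable and square integrable complex functions *)

Section complex_measurability.
Context d (T : measurableType d) (R : realType).
Implicit Types f g : T -> R[i].

Lemma cmeasurableM f g : cmeasurable f -> cmeasurable g ->
  cmeasurable (fun x => f x * g x).
Proof.
move=> [fr fi] [gr gi]; split.
  under eq_fun do rewrite complexReM.
  by apply: measurable_funB; exact: measurable_funM.
under eq_fun do rewrite complexImM.
by apply: measurable_funD; exact: measurable_funM.
Qed.

Lemma cmeasurable_conj f : cmeasurable f -> cmeasurable (fun x => conjc (f x)).
Proof.
move=> [fr fi]; split.
  by under eq_fun do rewrite complexRe_conj.
by under eq_fun do rewrite complexIm_conj; exact: measurableT_comp.
Qed.

Lemma cmeasurable_cst (z : R[i]) : cmeasurable (fun _ : T => z).
Proof. by split; exact: measurable_cst. Qed.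

Lemma cmeasurable_real (u : T -> R) :
  measurable_fun setT u -> cmeasurable (fun x => (u x)%:C).
Proof. by split => //=; exact: measurable_cst. Qed.

Lemma cmeasurable_expi (u : T -> R) :
  measurable_fun setT u -> cmeasurable (fun x => expi (u x)).
Proof.
move=> mu; split => /=; apply: measurableT_comp mu;
  apply: continuous_measurable_fun.
- exact: continuous_cos.
- exact: continuous_sin.
Qed.

Lemma cmeasurable_sum (I : Type) (s : seq I) (P : pred I) (F : I -> T -> R[i]) :
  (forall i, cmeasurable (F i)) ->
  cmeasurable (fun x => \sum_(i <- s | P i) F i x).
Proof.
move=> mF; elim: s => [|i s IH].
  rewrite (_ : (fun _ => _) = fun=> 0); first exact: cmeasurable_cst.
  by apply/funext => x; rewrite big_nil.
under eq_fun do rewrite big_cons.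
by case: (P i) => //; exact: (cmeasurableD (mF i) IH).
Qed.

Lemma cmeasurable_prod (I : Type) (s : seq I) (P : pred I) (F : I -> T -> R[i]) :
  (forall i, cmeasurable (F i)) ->
  cmeasurable (fun x => \prod_(i <- s | P i) F i x).
Proof.
move=> mF; elim: s => [|i s IH].
  rewrite (_ : (fun _ => _) = fun=> 1); first exact: cmeasurable_cst.
  by apply/funext => x; rewrite big_nil.
under eq_fun do rewrite big_cons.
by case: (P i) => //; exact: (cmeasurableM (mF i) IH).
Qed.

Lemma cmeasurable_comp d' (T' : measurableType d') (h : T' -> T) f :
  measurable_fun setT h -> cmeasurable f -> cmeasurable (fun x => f (h x)).
Proof.
move=> mh [fr fi].
by split; [exact: measurableT_comp fr mh|exact: measurableT_comp fi mh].
Qed.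

Variable mu : {measure set T -> \bar R}.

Lemma sqintP f : f \in sqint mu <->
  cmeasurable f /\ (\int[mu]_x ((cmod (f x)) ^+ 2)%:E < +oo)%E.
Proof. by rewrite inE; split => -[mf /L2norm_lty]. Qed.

Definition cintegrable f : Prop :=
  mu.-integrable setT (fun x => (complex.Re (f x))%:E) /\
  mu.-integrable setT (fun x => (complex.Im (f x))%:E).

Lemma cintegralD f g : cintegrable f -> cintegrable g ->
  cintegral mu (fun x => f x + g x) = cintegral mu f + cintegral mu g.
Proof.
move=> [fr fi] [gr gi]; apply: complex_eqP; rewrite ?complexReD ?complexImD/=.
  by under eq_Rintegral do rewrite complexReD; rewrite RintegralD.
by under eq_Rintegral do rewrite complexImD; rewrite RintegralD.
Qed.

Lemma cintegralZ (c : R[i]) f : cintegrable f ->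
  cintegral mu (fun x => c * f x) = c * cintegral mu f.
Proof.
move=> [fr fi].
have iZ (k : R) (h : T -> R) : mu.-integrable setT (EFin \o h) ->
    mu.-integrable setT (EFin \o (fun x => k * h x)).
  by move=> ih; exact: (integrableZl measurableT k ih).
apply: complex_eqP; rewrite ?complexReM ?complexImM/=.
  under eq_Rintegral do rewrite complexReM.
  by rewrite RintegralB ?RintegralZl//; exact: iZ.
under eq_Rintegral do rewrite complexImM.
by rewrite RintegralD ?RintegralZl//; exact: iZ.
Qed.

Lemma cintegral_conj f : cintegrable f ->
  cintegral mu (fun x => conjc (f x)) = conjc (cintegral mu f).
Proof.
move=> [_ fi]; apply: complex_eqP => /=.
  by under eq_Rintegral do rewrite complexRe_conj.
under eq_Rintegral do rewrite complexIm_conj -mulN1r.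
by rewrite RintegralZl// mulN1r.
Qed.

Lemma ae_eq_cintegral f g : cmeasurable f -> cmeasurable g ->
  {ae mu, forall x, f x = g x} -> cintegral mu f = cintegral mu g.
Proof.
move=> [fr fi] [gr gi] fg.
apply: complex_eqP; rewrite /= /Rintegral; congr fine.
  apply: ae_eq_integral => //; [exact/measurable_EFinP..|].
  by apply: filterS fg => x -> _.
apply: ae_eq_integral => //; [exact/measurable_EFinP..|].
by apply: filterS fg => x -> _.
Qed.

(** The domination |f g| <= |f|^2 + |g|^2 bounds the real and the imaginary part at once. *)
Lemma cintegrable_mul f g : f \in sqint mu -> g \in sqint mu ->
  cintegrable (fun x => f x * g x).
Proof.
move=> /sqintP[mf f2] /sqintP[mg g2].
have int2 h : cmeasurable h -> (\int[mu]_x ((cmod (h x)) ^+ 2)%:E < +oo)%E ->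
    mu.-integrable setT (fun x => ((cmod (h x)) ^+ 2)%:E).
  move=> mh h2; apply/integrableP; split.
    by apply/measurable_EFinP/measurable_funX; exact: measurable_cmod.
  by under eq_integral do rewrite gee0_abs ?lee_fin ?sqr_ge0//.
have [mr mi] := cmeasurableM mf mg.
have le2 x : cmod (f x) * cmod (g x) <= cmod (f x) ^+ 2 + cmod (g x) ^+ 2.
  have := sqr_ge0 (cmod (f x) - cmod (g x)).
  have := mulr_ge0 (cmod_ge0 (f x)) (cmod_ge0 (g x)); nra.
have i2 := integrableD measurableT (int2 _ mf f2) (int2 _ mg g2).
split; apply: le_integrable i2 => //; try exact/measurable_EFinP.
- move=> x _ /=; rewrite lee_fin.
  rewrite [leRHS]ger0_norm ?addr_ge0 ?sqr_ge0//; apply: le_trans (le2 x).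
  rewrite -cmodM -(@ler_pXn2r _ 2)// ?nnegrE ?cmod_ge0 ?normr_ge0//.
  by rewrite real_normK ?num_real// sqr_cmod lerDl sqr_ge0.
- move=> x _ /=; rewrite lee_fin.
  rewrite [leRHS]ger0_norm ?addr_ge0 ?sqr_ge0//; apply: le_trans (le2 x).
  rewrite -cmodM -(@ler_pXn2r _ 2)// ?nnegrE ?cmod_ge0 ?normr_ge0//.
  by rewrite real_normK ?num_real// sqr_cmod lerDr sqr_ge0.
Qed.

Lemma sqint_conj f : f \in sqint mu -> (fun x => conjc (f x)) \in sqint mu.
Proof.
move=> /sqintP[mf f2]; apply/sqintP; split; first exact: cmeasurable_conj.
by under eq_integral do rewrite cmod_conj.
Qed.

End complex_measurability.

(** * Inner product *)

Section inner_product.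
Context d (T : measurableType d) (R : realType).
Variable mu : {measure set T -> \bar R}.
Implicit Types f g h : L2 mu.
Local Open Scope quotient_scope.

Definition L2_mk (f : T -> R[i]) (f2 : f \in sqint mu) : L2 mu :=
  \pi_(L2 mu) (MkL2fun f2).

Lemma L2_mkE (f : T -> R[i]) (f2 : f \in sqint mu) :
  {ae mu, forall x, L2_mk f2 x = f x}.
Proof. exact: (repr_pi_ae (MkL2fun f2)). Qed.

Lemma L2_sqint f : (f : T -> R[i]) \in sqint mu.
Proof. exact: (L2fun_sqint (repr f)). Qed.

Lemma L2_cmeasurable f : cmeasurable (f : T -> R[i]).
Proof. by have /sqintP[] := L2_sqint f. Qed.

Lemma L2_ext f g : {ae mu, forall x, f x = g x} -> f = g.
Proof. by move=> /L2_eqP; rewrite !reprK. Qed.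

Lemma L2_addE f g : {ae mu, forall x, (f + g : L2 mu) x = f x + g x}.
Proof.
have := repr_pi_ae (repr f + repr g).
by rewrite L2_piD !reprK.
Qed.

Lemma L2_scaleE (c : R[i]) f : {ae mu, forall x, (c *: f : L2 mu) x = c * f x}.
Proof. exact: (repr_pi_ae (c *: repr f)). Qed.

Lemma L2_0E : {ae mu, forall x, (0 : L2 mu) x = 0}.
Proof.
have := L2_scaleE 0 0; rewrite scale0r; apply: filterS => x ->.
by rewrite mul0r.
Qed.

Lemma dot_integrable f g : cintegrable mu (fun x => f x * conjc (g x)).
Proof. exact: (cintegrable_mul (L2_sqint f) (sqint_conj (L2_sqint g))). Qed.

Lemma dot_cmeasurable f g : cmeasurable (fun x => f x * conjc (g x)).
Proof.
exact: (cmeasurableM (L2_cmeasurable f) (cmeasurable_conj (L2_cmeasurable g))).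
Qed.

Lemma dot_mkr f (g : T -> R[i]) (g2 : g \in sqint mu) :
  dot f (L2_mk g2) = cintegral mu (fun x => f x * conjc (g x)).
Proof.
have [mg _] := (sqintP mu g).1 g2.
apply: ae_eq_cintegral; first exact: dot_cmeasurable.
  exact: (cmeasurableM (L2_cmeasurable f) (cmeasurable_conj mg)).
by apply: filterS (L2_mkE g2) => x ->.
Qed.

Lemma dotDl f g h : dot (f + g) h = dot f h + dot g h.
Proof.
rewrite /dot -cintegralD; [|exact: dot_integrable..].
apply: ae_eq_cintegral; first exact: dot_cmeasurable.
  exact: (cmeasurableD (dot_cmeasurable f h) (dot_cmeasurable g h)).
by apply: filterS (L2_addE f g) => x ->; rewrite mulrDl.
Qed.

Lemma dotZl (c : R[i]) f h : dot (c *: f) h = c * dot f h.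
Proof.
rewrite /dot -cintegralZ; last exact: dot_integrable.
apply: ae_eq_cintegral; first exact: dot_cmeasurable.
  exact: (cmeasurableM (cmeasurable_cst _ c) (dot_cmeasurable f h)).
by apply: filterS (L2_scaleE c f) => x ->; rewrite mulrA.
Qed.

Lemma dotC f g : dot g f = conjc (dot f g).
Proof.
rewrite /dot -cintegral_conj; last exact: dot_integrable.
congr cintegral; apply/funext => x.
by rewrite rmorphM/= conjcK mulrC.
Qed.

Lemma dotDr f g h : dot f (g + h) = dot f g + dot f h.
Proof. by rewrite dotC dotDl conjcD -!dotC. Qed.

Lemma dotZr (c : R[i]) f h : dot f (c *: h) = conjc c * dot f h.
Proof. by rewrite dotC dotZl conjcM -!dotC. Qed.

Lemma dot0l h : dot 0 h = 0.
Proof. by rewrite -(scale0r (0 : L2 mu)) dotZl mul0r. Qed.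

Lemma dot0r h : dot h 0 = 0.
Proof. by rewrite dotC dot0l conjc0. Qed.

Lemma dotBl f g h : dot (f - g) h = dot f h - dot g h.
Proof. by rewrite -scaleN1r dotDl dotZl mulN1r. Qed.

Lemma dot_suml (I : Type) (s : seq I) (P : pred I) (F : I -> L2 mu) h :
  dot (\sum_(i <- s | P i) F i) h = \sum_(i <- s | P i) dot (F i) h.
Proof.
by elim/big_rec2: _ => [|i z f _ <-]; rewrite ?dot0l ?dotDl.
Qed.

Lemma dot_sumr (I : Type) (s : seq I) (P : pred I) (F : I -> L2 mu) h :
  dot h (\sum_(i <- s | P i) F i) = \sum_(i <- s | P i) dot h (F i).
Proof.
by elim/big_rec2: _ => [|i z f _ <-]; rewrite ?dot0r ?dotDr.
Qed.

(** A real-valued counterpart of [norm2 f ^+ 2], which keeps the Hilbert space algebra out of the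
    extended reals. *)
Definition sqnorm f : R := complex.Re (dot f f).

Lemma sqnorm_integral f :
  (sqnorm f)%:E = (\int[mu]_x ((cmod (f x)) ^+ 2)%:E)%E.
Proof.
have /sqintP[mf f2] := L2_sqint f.
rewrite /sqnorm /dot /= /Rintegral fineK; last first.
  by have [i _] := dot_integrable f f; exact: integrable_fin_num i.
by apply: eq_integral => x _; rewrite mulc_conj.
Qed.

Lemma sqnorm_ge0 f : 0 <= sqnorm f.
Proof.
rewrite -lee_fin sqnorm_integral integral_ge0// => x _.
by rewrite lee_fin sqr_ge0.
Qed.

Lemma dotff f : dot f f = (sqnorm f)%:C.
Proof.
apply: complex_eqP => //=; rewrite /dot /=.
under eq_Rintegral do rewrite mulc_conj/=.
by rewrite /Rintegral integral0.
Qed.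

Lemma norm2E f : norm2 f = (Num.sqrt (sqnorm f))%:E.
Proof.
rewrite /norm2 /L2norm unlock.
rewrite (eq_integral (fun x => ((cmod (f x)) ^+ 2)%:E)); last first.
  by move=> x _; rewrite abse_EFin poweR_EFin ger0_norm ?cmod_ge0//
    powR_mulrn ?cmod_ge0.
by rewrite -sqnorm_integral poweR_EFin powR12_sqrt// sqnorm_ge0.
Qed.

Lemma sqr_norm2 f : (norm2 f ^+ 2)%E = (sqnorm f)%:E.
Proof. by rewrite norm2E expe2 -EFinM -expr2 sqr_sqrtr// sqnorm_ge0. Qed.

Lemma sqnorm_eq0 f : sqnorm f = 0 -> f = 0.
Proof.
move=> f0; have := sqnorm_integral f; rewrite f0 => /esym i0.
have /ae_eq_integral_abs : measurable_fun setT
    (fun x => ((cmod (f x)) ^+ 2)%:E).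
  by apply/measurable_EFinP/measurable_funX/measurable_cmod/L2_cmeasurable.
move=> /(_ mu measurableT)[+ _].
under eq_integral do rewrite gee0_abs ?lee_fin ?sqr_ge0//.
move=> /(_ i0) f0'; apply: L2_ext.
apply: filterS2 L2_0E f0' => x -> /(_ Logic.I)[] /eqP.
by rewrite sqrf_eq0 => /eqP/cmod_eq0.
Qed.

Lemma sqnormZ (c : R[i]) f : sqnorm (c *: f) = cmod c ^+ 2 * sqnorm f.
Proof.
rewrite {1}/sqnorm dotZl dotZr mulrA mulc_conj dotff complexReM/=.
by rewrite mul0r subr0.
Qed.

Lemma sqnormD f g :
  sqnorm (f + g) = sqnorm f + sqnorm g + 2 * complex.Re (dot f g).
Proof.
rewrite {1}/sqnorm dotDl !dotDr !complexReD -!/(sqnorm _).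
by rewrite (dotC f g) complexRe_conj; ring.
Qed.

Lemma sqnorm_orthonormal n (e : 'I_n -> L2 mu) (c : 'I_n -> R[i]) :
  orthonormal_family e ->
  sqnorm (\sum_(i < n) c i *: e i) = \sum_(i < n) cmod (c i) ^+ 2.
Proof.
move=> oe; rewrite /sqnorm dot_suml complexRe_sum.
apply: eq_bigr => i _; rewrite dot_sumr (bigD1 i)//= big1 ?addr0.
  by rewrite dotZl dotZr oe eqxx mulr1 mulc_conj.
by move=> j ji; rewrite dotZl dotZr oe eq_sym (negPf ji) !mulr0.
Qed.

(** With g the orthogonal projection of f onto the span, <f, g> = |g|^2, so that |f - g|^2 = |f|^2 -
    |g|^2 is nonnegative. *)
Lemma bessel n (e : 'I_n -> L2 mu) f : orthonormal_family e ->
  \sum_(i < n) cmod (dot (e i) f) ^+ 2 <= sqnorm f.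
Proof.
move=> oe; set g := \sum_(i < n) dot f (e i) *: e i.
have dg i : dot (e i) f = conjc (dot f (e i)) by exact: dotC.
have Egg : sqnorm g = \sum_(i < n) cmod (dot (e i) f) ^+ 2.
  rewrite sqnorm_orthonormal//; apply: eq_bigr => i _.
  by rewrite dg cmod_conj.
have := sqnorm_ge0 (f + (-1) *: g).
have -> : sqnorm (f + (-1) *: g) = sqnorm f - sqnorm g.
  rewrite sqnormD sqnormZ dotZr (_ : dot f g = (sqnorm g)%:C).
    by rewrite cmodN cmod1 conjcN1 mulN1r /=; ring.
  rewrite dot_sumr Egg rmorph_sum; apply: eq_bigr => i _.
  by rewrite dotZr mulrC mulc_conj dg cmod_conj.
by rewrite subr_ge0 -Egg.
Qed.

(** Bessel's inequality for the one-element family f / |f|. *)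
Lemma cauchy_schwarz f g : cmod (dot f g) ^+ 2 <= sqnorm f * sqnorm g.
Proof.
have [f0|f0] := eqVneq (sqnorm f) 0.
  by rewrite (sqnorm_eq0 f0) dot0l cmod0 expr0n/=
    mulr_ge0// sqnorm_ge0.
have fp : 0 < sqnorm f by rewrite lt_def f0 sqnorm_ge0.
pose k : R := (Num.sqrt (sqnorm f))^-1.
have k2 : k ^+ 2 = (sqnorm f)^-1 by rewrite exprVn sqr_sqrtr// sqnorm_ge0.
have oe : orthonormal_family (fun _ : 'I_1 => k%:C *: f).
  move=> i j; rewrite !ord1 eqxx dotff sqnormZ cmod_real real_normK ?num_real//.
  by rewrite k2 mulVf.
have := bessel g oe; rewrite big_ord1 dotZl cmodM exprMn cmod_real.
by rewrite real_normK ?num_real// k2 mulrC ler_pdivrMr// mulrC.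
Qed.

Definition nrm f : R := Num.sqrt (sqnorm f).

Lemma nrm_ge0 f : 0 <= nrm f. Proof. exact: sqrtr_ge0. Qed.

Lemma sqr_nrm f : nrm f ^+ 2 = sqnorm f.
Proof. by rewrite sqr_sqrtr// sqnorm_ge0. Qed.

Lemma nrmZ (c : R[i]) f : nrm (c *: f) = cmod c * nrm f.
Proof.
by rewrite /nrm sqnormZ sqrtrM ?sqr_ge0// sqrtr_sqr ger0_norm// cmod_ge0.
Qed.

Lemma nrm0 : nrm (0 : L2 mu) = 0.
Proof. by rewrite -(scale0r (0 : L2 mu)) nrmZ cmod0 mul0r. Qed.

Lemma nrmD f g : nrm (f + g) <= nrm f + nrm g.
Proof.
rewrite -(@ler_pXn2r _ 2)// ?nnegrE ?addr_ge0 ?nrm_ge0//.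
rewrite sqr_nrm sqnormD sqrrD !sqr_nrm.
suff : complex.Re (dot f g) <= nrm f * nrm g by lra.
apply: le_trans (ler_Re_cmod _) _.
rewrite -(@ler_pXn2r _ 2)// ?nnegrE ?cmod_ge0 ?mulr_ge0 ?nrm_ge0//.
by rewrite exprMn !sqr_nrm cauchy_schwarz.
Qed.

Lemma nrm_sum (I : Type) (s : seq I) (P : pred I) (F : I -> L2 mu) :
  nrm (\sum_(i <- s | P i) F i) <= \sum_(i <- s | P i) nrm (F i).
Proof.
elim/big_ind2: _ => //; first by rewrite nrm0.
by move=> f x g y hf hg; apply: le_trans (nrmD _ _) (lerD hf hg).
Qed.

Lemma dot_ext f g : (forall h, dot f h = dot g h) -> f = g.
Proof.
move=> fg; apply/eqP; rewrite -subr_eq0; apply/eqP/sqnorm_eq0.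
by rewrite /sqnorm dotBl fg subrr.
Qed.

End inner_product.

(** * Operators between L2 spaces *)

(** With B the sum of the b_i^2, the sum of the squares (A b_i - P a_i)^2 equals A (A B - P^2), and
    A can be cancelled unless all a_i vanish. *)
Lemma sum_cauchy_schwarz (R : realFieldType) (I : finType) (a b : I -> R) :
  (\sum_i a i * b i) ^+ 2 <= (\sum_i a i ^+ 2) * (\sum_i b i ^+ 2).
Proof.
set A := \sum_i a i ^+ 2; set P := \sum_i a i * b i.
have A0 : 0 <= A by apply: sumr_ge0 => i _; exact: sqr_ge0.
have [A_eq0|A_neq0] := eqVneq A 0.
  rewrite A_eq0 mul0r (_ : P = 0) ?expr0n//; apply: big1 => i _.
  have /psumr_eq0P : forall i : I, true -> 0 <= a i ^+ 2.
    by move=> j _; exact: sqr_ge0.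
  by move=> /(_ A_eq0 i isT)/eqP; rewrite sqrf_eq0 => /eqP ->; rewrite mul0r.
have : 0 <= \sum_i (A * b i - P * a i) ^+ 2.
  by apply: sumr_ge0 => i _; exact: sqr_ge0.
have -> : \sum_i (A * b i - P * a i) ^+ 2 = A * (A * (\sum_i b i ^+ 2) - P ^+ 2).
  transitivity (A ^+ 2 * (\sum_i b i ^+ 2) - 2 * A * P * P + P ^+ 2 * A).
    rewrite (eq_bigr (fun i => A ^+ 2 * b i ^+ 2 +
        ((- (2 * A * P)) * (a i * b i) + P ^+ 2 * a i ^+ 2))).
      by rewrite !big_split/= -!mulr_sumr -/A -/P; ring.
    by move=> i _; ring.
  by ring.
by rewrite pmulr_rge0 ?subr_ge0// lt_def A_neq0.
Qed.

(** A matrix with more rows than columns is not row free; any nonzero row of its left kernel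
    provides the coefficients. *)
Lemma left_kernel (F : fieldType) n (J : finType) (M : 'I_n -> J -> F) :
  (#|J| < n)%N ->
  exists c : 'I_n -> F, (exists i, c i != 0) /\
    forall j, \sum_(i < n) c i * M i j = 0.
Proof.
move=> Jn; pose A := \matrix_(i < n, j < #|J|) M i (enum_val j).
have : kermx A != 0.
  rewrite kermx_eq0 /row_free; apply/negP => /eqP rA.
  by have := rank_leq_col A; rewrite rA leqNgt Jn.
move=> /matrix0Pn[i0 [j0 k0]].
exists (fun i => kermx A i0 i); split; first by exists j0.
move=> j; have /matrixP/(_ i0 (enum_rank j)) := mulmx_ker A.
rewrite !mxE => {2}<-; apply: eq_bigr => i _.
by rewrite !mxE enum_rankK.
Qed.

(** * Rank of an operator between L^2 spaces *)

Section op_rank.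
Context d1 d2 (X : measurableType d1) (Y : measurableType d2) (R : realType).
Variables (mu : {measure set X -> \bar R}) (nu : {measure set Y -> \bar R}).

(** More than #|J| images have a coefficient matrix with a nontrivial left kernel, hence satisfy a
    nontrivial relation. *)
Lemma op_rank_le_span (J : finType) (h : J -> L2 nu) (T : L2 mu -> L2 nu) :
  (forall f, exists c : J -> R[i], T f = \sum_j c j *: h j) ->
  (op_rank T <= #|J|%:R%:E)%E.
Proof.
move=> Th; apply: ge_ereal_sup => _ [n [v vfree] <-].
rewrite lee_fin ler_nat leqNgt; apply/negP => Jn.
have /choice[M TM] : forall i, exists c : J -> R[i],
    T (v i) = \sum_j c j *: h j by [].
have [c [[i ci0] cM]] := left_kernel M Jn.
move: ci0; rewrite vfree ?eqxx//.
under eq_bigr do rewrite TM scaler_sumr.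
rewrite exchange_big/= big1// => j _.
under eq_bigr do rewrite scalerA.
by rewrite -scaler_suml cM scale0r.
Qed.

(** Were there no such relation, the images would be independent and the rank at least n. For linear
    T the relation is a combination of the [v i] in the kernel of T, which is how a dimension count
    enters. *)
Lemma op_rank_kernel (T : L2 mu -> L2 nu) (m n : nat) (v : 'I_n -> L2 mu) :
  (op_rank T <= m%:R%:E)%E -> (m < n)%N ->
  exists c : 'I_n -> R[i], (exists i, c i != 0) /\
    \sum_(i < n) c i *: T (v i) = 0.
Proof.
move=> Tm mn; apply: contrapT => nc.
have : (n%:R%:E <= op_rank T)%E.
  apply: ereal_sup_ubound; exists n => //; exists v => c c0 i.
  by apply: contrapT => /eqP ci; apply: nc; exists c; split => //; exists i.
by move=> /le_trans/(_ Tm); rewrite lee_fin ler_nat leqNgt mn.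
Qed.

End op_rank.

(** * Singular values and spectral projections under finite rank approximation *)

Section bounded_operators.
Context d1 d2 (X : measurableType d1) (Y : measurableType d2) (R : realType).
Variables (mu : {measure set X -> \bar R}) (nu : {measure set Y -> \bar R}).

Lemma opnorm_le (T : L2 mu -> L2 nu) (b : R) : 0 <= b ->
  (forall f, nrm (T f) <= b * nrm f) -> (opnorm T <= b%:E)%E.
Proof.
move=> b0 Tb; apply: ge_ereal_sup => _ [f f1 <-].
rewrite norm2E lee_fin; apply: le_trans (Tb f) _.
by move: f1; rewrite /= norm2E lee_fin => f1; rewrite ler_piMr.
Qed.

(* [adjoint] and [spectral_projection] default to zero when no witness exists;
   since the bounds below hold for zero too, neither the existence of adjoints
   nor the spectral theorem is needed. *)
Lemma adjoint_or0 (T : L2 mu -> L2 nu) :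
  is_adjoint T (adjoint T) \/ adjoint T = fun=> 0.
Proof. by rewrite /adjoint; case: xgetP; [left|right]. Qed.

Section finite_rank_approximation.
Variables (K KN : {linear L2 mu -> L2 nu}) (m : nat) (b : R).
Hypothesis KN_rank : (op_rank KN <= m%:R%:E)%E.
Hypothesis b0 : 0 <= b.
Hypothesis KKN : forall f, nrm (K f - KN f) <= b * nrm f.

Lemma kernel_bound f : KN f = 0 -> sqnorm (K f) <= b ^+ 2 * sqnorm f.
Proof.
move=> f0; have := KKN f; rewrite f0 subr0 -!sqr_nrm -exprMn.
by rewrite ler_pXn2r// ?nnegrE ?mulr_ge0 ?nrm_ge0.
Qed.

(* A combination of m + 1 orthonormal eigenvectors of K^* K lies in the kernel
   of KN; there |K g| >= l |g| while |K g| <= b |g|. *)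
Lemma singular_value_le : (singular_value K m.+1 <= b%:E)%E.
Proof.
apply: ge_ereal_sup => x [->|[l [l0 [e [s [oe Ke]]]] <-]].
  by rewrite lee_fin.
(* If [adjoint K] is the default zero, the eigenvector equation forces s_0 = 0, against s_0 >= l >
   0. *)
have [adj|adj0] := adjoint_or0 K; last first.
  have [ls] := Ke ord0; rewrite adj0 => /esym/(congr1 (@sqnorm _ _ _ _)).
  rewrite sqnormZ /sqnorm oe eqxx dot0l => /eqP.
  rewrite mulr1 sqrf_eq0 cmod_real normr_eq0 sqrf_eq0 => /eqP s0.
  by move: ls; rewrite s0 leNgt l0.
have [c [[i0 ci0] cKN]] := op_rank_kernel e KN_rank (ltnSn m).
set g := \sum_(i < m.+1) c i *: e i.
have KNg : KN g = 0.
  by rewrite linear_sum -[RHS]cKN; apply: eq_bigr => i _; rewrite linearZ.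
have Eg : sqnorm g = \sum_(i < m.+1) cmod (c i) ^+ 2 by exact: sqnorm_orthonormal.
have g0 : 0 < sqnorm g.
  rewrite Eg (bigD1 i0)//= ltr_wpDr ?sumr_ge0//; first by move=> i _; exact: sqr_ge0.
  rewrite exprn_gt0// lt_def cmod_ge0 andbT.
  by apply: contra ci0 => /eqP/cmod_eq0 ->.
have dge i : dot g (e i) = c i.
  rewrite dot_suml (bigD1 i)//= big1 ?addr0 => [|j ji].
    by rewrite dotZl oe eqxx mulr1.
  by rewrite dotZl oe (negPf ji) mulr0.
have Kg : sqnorm (K g) = \sum_(i < m.+1) s i ^+ 2 * cmod (c i) ^+ 2.
  have KgE : K g = \sum_(i < m.+1) c i *: K (e i).
    by rewrite linear_sum; apply: eq_bigr => i _; rewrite linearZ.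
  (* Only the left factor is expanded: the adjoint then turns <K g, K e_i> into <g, K^* K e_i>, and
     the eigenvector equation applies. *)
  rewrite /sqnorm {1}KgE dot_suml complexRe_sum.
  apply: eq_bigr => i _; rewrite dotZl.
  rewrite (dotC (K g)) adj (Ke i).2 dotZr dge conjcM conjcK mulrCA.
  by rewrite mulc_conj -rmorphM.
have : l ^+ 2 * sqnorm g <= b ^+ 2 * sqnorm g.
  apply: le_trans (kernel_bound KNg); rewrite Kg Eg mulr_sumr.
  apply: ler_sum => i _; apply: ler_wpM2r; first exact: sqr_ge0.
  by have [ls _] := Ke i; rewrite ler_pXn2r// nnegrE ltW// (lt_le_trans l0).
by rewrite ler_pM2r// ler_pXn2r ?nnegrE ?(ltW l0)// lee_fin.
Qed.

(* The spectral measure of a vector in the range of E(]eps, 1 - eps[) lives on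
   ]eps, 1 - eps[, hence <S g, g> > eps |g|^2 for g != 0 in that range. *)
Lemma Lambda_le (eps : R) : b ^+ 2 <= eps ->
  (Lambda eps (adjoint K \o K) <= m%:R%:E)%E.
Proof.
move=> beps; set S := adjoint K \o K; set A := `]eps, (1 - eps)[%classic.
have mA : measurable A by exact: measurable_itv.
rewrite /Lambda -/A /spectral_projection.
(* Without a spectral measure the projection is the zero map, whose range is spanned by the empty
   family. *)
case: xgetP => [E _ [E1 EI Esa Em]|_]; last first.
  apply: le_trans (_ : #|'I_0|%:R%:E <= _)%E; last first.
    by rewrite card_ord lee_fin ler_nat.
  apply: (op_rank_le_span (h := fun=> 0)) => f; exists (fun=> 0).
  by rewrite big_ord0.
apply: ge_ereal_sup => _ [n [v wfree] <-].
rewrite lee_fin ler_nat leqNgt; apply/negP => mn.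
pose w i := E A (v i).
have [c [[i0 ci0] cKN]] := op_rank_kernel w KN_rank mn.
set g := \sum_(i < n) c i *: w i.
have KNg : KN g = 0.
  by rewrite linear_sum -[RHS]cKN; apply: eq_bigr => i _; rewrite linearZ.
(* Self-adjointness supplies the linearity of [E A] used here: paired with h, the projection moves
   off the sum and back onto each term. *)
have EAg : E A g = g.
  apply: dot_ext => h; rewrite Esa// !dot_suml; apply: eq_bigr => i _.
  by rewrite !dotZl -Esa// -EI// setIid.
have g0 : sqnorm g != 0.
  by apply/eqP => /sqnorm_eq0 g0; move: ci0; rewrite (wfree c) ?eqxx.
have [ms [mE mi mS]] := Em g.
have Sg : complex.Re (dot (S g) g) <= eps * sqnorm g.
  have eps0 : 0 <= eps by apply: le_trans beps; exact: sqr_ge0.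
  have [adj|adj0] := adjoint_or0 K; last first.
    have -> : S g = 0 by rewrite /S/= adj0.
    by rewrite dot0l mulr_ge0// sqnorm_ge0.
  rewrite dotC -adj complexRe_conj; apply: le_trans (kernel_bound KNg) _.
  by rewrite ler_wpM2r// sqnorm_ge0.
have msT : ms setT = (sqnorm g)%:E by rewrite mE// E1 sqr_norm2.
(* As g = E(A) g, the mass of the complement is |E(~A) E(A) g|^2 = |E(empty) g|^2. *)
have msA : ms (~` A) = 0%E.
  have mCA := measurableC mA.
  by rewrite mE// -EAg -EI// setICl -mE ?measure0.
have ie : ms.-integrable setT (fun=> eps%:E).
  apply/integrableP; split; first exact: measurable_cst.
  by rewrite (integral_cst ms measurableT `|eps%:E|%E) [X in (_ * X)%E]msT ltry.
have int_le0 : (\int[ms]_t (t%:E - eps%:E) <= 0)%E.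
  rewrite (integralB measurableT mi ie) (integral_cst ms measurableT eps%:E).
  rewrite [X in (_ * X)%E]msT -[X in (X - _)%E]fineK; last first.
    exact: integrable_fin_num mi.
  by rewrite lee_fin subr_le0; move: Sg; rewrite mS.
have ae_pos : {ae ms, forall t, 0 < t - eps}.
  exists (~` A); split => //; first exact: measurableC.
  move=> t /= tA; apply: contra_not tA.
  by rewrite /A/= in_itv/= subr_gt0 => /andP[].
have msub : measurable_fun setT (fun t : R => (t%:E - eps%:E)%E).
  exact: emeasurable_funB (measurable_int _ mi) (measurable_int _ ie).
have : (\int[ms]_t `|t%:E - eps%:E| = 0)%E.
  apply/eqP; rewrite eq_le integral_ge0// andbT.
  rewrite (@ae_eq_integral _ _ _ ms setT (fun t => t%:E - eps%:E)%E)//.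
    exact: measurableT_comp.
  by apply: filterS ae_pos => t t0 _; rewrite gee0_abs// lee_fin ltW.
move=> /(ae_eq_integral_abs ms measurableT msub) ae0.
(* The integrand t - eps is positive almost everywhere, yet its nonpositive integral makes it zero
   almost everywhere. So the whole line is null, while its mass is |g|^2. *)
have [N [mN N0 TN]] : {ae ms, forall t : R, False}.
  apply: filterS2 ae_pos ae0 => t t0 /(_ Logic.I)[] t1.
  by move: t0; rewrite t1 ltxx.
move: g0; rewrite -eqe -msT -measure_le0 -N0 => /negP; apply.
by apply: le_measure; rewrite ?inE// => t _; exact: TN.
Qed.

End finite_rank_approximation.
End bounded_operators.

(** * Hilbert-Schmidt norm and operator norm *)

Section hs_norm_bounds.
Context d1 d2 (X : measurableType d1) (Y : measurableType d2) (R : realType).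
Variables (mu : {measure set X -> \bar R}) (nu : {measure set Y -> \bar R}).

Lemma orthonormal_basis_tuple (B : set (L2 mu)) (s : seq (L2 mu)) :
  orthonormal_basis B -> uniq s -> {in s, forall e, B e} ->
  orthonormal_family (fun i : 'I_(size s) => s`_i).
Proof.
move=> [oB _] us sB i j; rewrite oB; last 2 first.
  by apply: sB; exact: mem_nth.
  by apply: sB; exact: mem_nth.
by rewrite nth_uniq.
Qed.

(** The approximating families in [orthonormal_basis] may repeat a basis vector. Merging the
    coefficients of equal vectors gives a combination to which orthonormality applies. *)
Lemma sum_undup_combination n (e : 'I_n -> L2 mu) (c : 'I_n -> R[i]) :
  \sum_(i < n) c i *: e i =
  \sum_(u <- undup (codom e)) (\sum_(i < n | e i == u) c i) *: u.
Proof.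
under [RHS]eq_bigr do rewrite scaler_suml.
rewrite (exchange_big_dep xpredT)//=; apply: eq_bigr => i _.
have ei : e i \in undup (codom e) by rewrite mem_undup codom_f.
rewrite big_mkcond (bigD1_seq _ ei (undup_uniq _))/= eqxx big1 ?addr0// => u.
by rewrite eq_sym => /negPf ->.
Qed.

(** The sum over B is a supremum over its finite subsets, and each of these, listed without
    repetition, is an orthonormal family. *)
Lemma hs_norm_le (B : set (L2 mu)) (T : L2 mu -> L2 nu) (b : R) : 0 <= b ->
  orthonormal_basis B ->
  (forall n (e : 'I_n -> L2 mu), orthonormal_family e ->
    \sum_(i < n) sqnorm (T (e i)) <= b ^+ 2) ->
  (hs_norm B T <= b%:E)%E.
Proof.
move=> b0 oB Tb; rewrite /hs_norm.
have le_b2 : (\esum_(e in B) norm2 (T e) ^+ 2 <= (b ^+ 2)%:E)%E.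
  apply: ge_ereal_sup => _ [A [/finite_seqP[s ->] sB] <-].
  have -> : [set` s] = [set` undup s].
    by apply/seteqP; split => x /=; rewrite mem_undup.
  rewrite -fsbig_seq ?undup_uniq//.
  rewrite (eq_bigr (fun e => (sqnorm (T e))%:E)); last first.
    by move=> e _; exact: sqr_norm2.
  rewrite sumEFin lee_fin (big_nth 0) big_mkord.
  apply: Tb (orthonormal_basis_tuple oB (undup_uniq s) _) => e.
  by rewrite mem_undup => es; exact: sB.
apply: le_trans (gt0_ler_poweR _ _ _ le_b2) _; rewrite ?invr_ge0//.
- rewrite in_itv/= leey andbT esum_ge0// => e _.
  by rewrite -expe2 sqr_norm2 lee_fin sqnorm_ge0.
- by rewrite in_itv/= leey andbT lee_fin sqr_ge0.
- by rewrite poweR_EFin powR12_sqrt ?sqr_ge0// sqrtr_sqr ger0_norm.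
Qed.

(** On finite combinations g of basis vectors, the triangle inequality and Cauchy-Schwarz give |T g|
    <= |g| sqrt h, with h the sum over B. Such g are dense, and the a priori bound [M] makes T
    continuous, so the estimate reaches every f. *)
Lemma opnorm_le_hs_norm (B : set (L2 mu)) (T : {linear L2 mu -> L2 nu}) (M : R) :
  0 <= M -> (forall f, nrm (T f) <= M * nrm f) -> orthonormal_basis B ->
  (opnorm T <= hs_norm B T)%E.
Proof.
move=> M0 TM oB; rewrite /hs_norm.
have : (0 <= \esum_(e in B) norm2 (T e) ^+ 2)%E.
  by apply: esum_ge0 => e _; rewrite sqr_norm2 lee_fin sqnorm_ge0.
case EH : (\esum_(e in B) norm2 (T e) ^+ 2)%E => [h| |]//; last first.
  by rewrite poweRyr ?leey// invr_neq0.
rewrite lee_fin => h0.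
rewrite poweR_EFin powR12_sqrt//.
have sum_le (s : seq (L2 mu)) : uniq s -> {in s, forall e, B e} ->
    \sum_(e <- s) sqnorm (T e) <= h.
  move=> us sB; rewrite -lee_fin -EH; apply: esum_ge.
  exists [set` s]; first by split; [exact: finite_seq|exact: sB].
  rewrite -fsbig_seq// -sumEFin; under [leRHS]eq_bigr do rewrite sqr_norm2.
  exact: lexx.
have span_le n (e : 'I_n -> L2 mu) (c : 'I_n -> R[i]) : (forall i, B (e i)) ->
    nrm (T (\sum_(i < n) c i *: e i)) <=
    nrm (\sum_(i < n) c i *: e i) * Num.sqrt h.
  move=> eB; rewrite sum_undup_combination; set s := undup _.
  have us : uniq s by exact: undup_uniq.
  have sB : {in s, forall u, B u}.
    by move=> u; rewrite mem_undup => /codomP[i ->].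
  pose b u := \sum_(i < n | e i == u) c i.
  rewrite (eq_bigr (fun u => b u *: u))// linear_sum.
  rewrite !(big_nth (0 : L2 mu)) !big_mkord.
  apply: le_trans (nrm_sum _ _ _) _.
  rewrite (eq_bigr (fun j : 'I_(size s) => cmod (b s`_j) * nrm (T s`_j))); last first.
    by move=> j _; rewrite linearZ nrmZ.
  rewrite -(@ler_pXn2r _ 2)// ?nnegrE ?mulr_ge0 ?nrm_ge0 ?sqrtr_ge0//; last first.
    by apply: sumr_ge0 => j _; rewrite mulr_ge0 ?cmod_ge0 ?nrm_ge0.
  rewrite exprMn sqr_nrm sqr_sqrtr// sqnorm_orthonormal; last first.
    exact: (orthonormal_basis_tuple oB us sB).
  apply: le_trans (sum_cauchy_schwarz _ _) _.
  apply: ler_wpM2l; first by apply: sumr_ge0 => j _; exact: sqr_ge0.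
  have := sum_le s us sB; rewrite (big_nth 0) big_mkord.
  by under eq_bigr do rewrite -sqr_nrm.
apply: ge_ereal_sup => _ [f f1 <-].
move: f1; rewrite /= !norm2E !lee_fin -!/(nrm _) => f1.
apply/ler_addgt0Pr => eps eps0.
(* Approximating f within eps / D costs sqrt h * (eps / D) through |g| and M * (eps / D) through T
   (f - g), together at most eps; the 1 keeps D positive. *)
set D := Num.sqrt h + M + 1.
have D0 : 0 < D by rewrite ltr_wpDl ?addr_ge0 ?sqrtr_ge0.
have [_ /(_ f (eps / D))[|n [e [c [eB fe]]]]] := oB; first by rewrite divr_gt0.
move: fe; set g := \sum_(i < n) c i *: e i; rewrite norm2E lte_fin -/(nrm _) => fg.
have gn : nrm g <= 1 + eps / D.
  have -> : g = f + (-1) *: (f - g) by rewrite scaleN1r opprB addrC subrK.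
  by apply: le_trans (nrmD _ _) _; rewrite nrmZ cmodN cmod1 mul1r lerD// ltW.
have -> : T f = T g + T (f - g) by rewrite -linearD addrC subrK.
apply: le_trans (nrmD _ _) _.
apply: (@le_trans _ _ ((1 + eps / D) * Num.sqrt h + M * (eps / D))).
  rewrite lerD//.
    by apply: le_trans (span_le _ _ _ eB) _; rewrite ler_wpM2r ?sqrtr_ge0.
  by apply: le_trans (TM _) _; rewrite ler_wpM2l// ltW.
rewrite mulrDl mul1r -addrA lerD2l (mulrC M) -mulrDr -mulrA ler_piMr ?(ltW eps0)//.
by rewrite mulrC ler_pdivrMr// mul1r lerDl.
Qed.

End hs_norm_bounds.

(** * Integral operators with square integrable kernels *)

Section kernel_operator.
Context d1 d2 (X : measurableType d1) (Y : measurableType d2) (R : realType).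
Variables (mu : {sigma_finite_measure set X -> \bar R}).
Variables (nu : {sigma_finite_measure set Y -> \bar R}).

(** Tonelli's theorem applies separately to the positive and the negative part of an arbitrary
    measurable g. *)
Lemma measurable_Rintegral (g : X * Y -> R) : measurable_fun setT g ->
  measurable_fun setT (fun y => \int[mu]_x g (x, y)).
Proof.
move=> mg; have meg : measurable_fun setT (EFin \o g) by exact/measurable_EFinP.
have mp : measurable_fun setT (fubini_G mu (EFin \o g)^\+%E).
  by apply: measurable_fun_fubini_tonelli_G => //; exact: measurable_funepos.
have mn : measurable_fun setT (fubini_G mu (EFin \o g)^\-%E).
  by apply: measurable_fun_fubini_tonelli_G => //; exact: measurable_funeneg.
apply: (measurableT_comp (fine_measurable measurableT)).
rewrite (_ : (fun y => \int[mu]_x (g (x, y))%:E)%E = (fun y =>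
    fubini_G mu (EFin \o g)^\+%E y - fubini_G mu (EFin \o g)^\-%E y)%E).
  exact: emeasurable_funB.
apply/funext => y; rewrite integralE /fubini_G.
by congr (_ - _)%E; apply: eq_integral => x _; rewrite unlock.
Qed.

Section kernel.
Variable k : X * Y -> R[i].
Hypothesis mk : cmeasurable k.

Definition kernel_sqint (y : Y) : \bar R :=
  (\int[mu]_x ((cmod (k (x, y))) ^+ 2)%:E)%E.

Lemma measurable_sqr_cmod_kernel :
  measurable_fun setT (fun z => ((cmod (k z)) ^+ 2)%:E).
Proof. by apply/measurable_EFinP/measurable_funX; exact: measurable_cmod. Qed.

Lemma kernel_sqint_ge0 y : (0 <= kernel_sqint y)%E.
Proof. by apply: integral_ge0 => x _; rewrite lee_fin sqr_ge0. Qed.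

Lemma measurable_kernel_sqint : measurable_fun setT kernel_sqint.
Proof.
apply: (measurable_fun_fubini_tonelli_G
  (fun z => ((cmod (k z)) ^+ 2)%:E)).
  exact: measurable_sqr_cmod_kernel.
by move=> z; rewrite lee_fin sqr_ge0.
Qed.

Lemma integral_kernel_sqint : (\int[nu]_y kernel_sqint y =
  \int[(mu \x nu)%E]_z ((cmod (k z)) ^+ 2)%:E)%E.
Proof.
rewrite (fubini_tonelli2 _ measurable_sqr_cmod_kernel)// => z.
by rewrite lee_fin sqr_ge0.
Qed.

Hypothesis k2 : (\int[nu]_y kernel_sqint y < +oo)%E.

Lemma kernel_sqint_ae : {ae nu, forall y, (kernel_sqint y < +oo)%E}.
Proof.
have : nu.-integrable setT kernel_sqint.
  apply/integrableP; split; first exact: measurable_kernel_sqint.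
  by under eq_integral do rewrite gee0_abs ?kernel_sqint_ge0//.
move=> /(integrable_ae measurableT); apply: filterS => y /(_ Logic.I).
by move=> /fin_numPlt/andP[].
Qed.

(** Conjugated because [dot] is conjugate-linear in its second argument: the integral of k(., y) f
    is then [dot] of f with the section. *)
Definition kernel_section (y : Y) (x : X) : R[i] := conjc (k (x, y)).

Lemma kernel_section_sqint y :
  (kernel_sqint y < +oo)%E -> kernel_section y \in sqint mu.
Proof.
move=> ky; apply: sqint_conj; apply/sqintP; split=> //.
exact: (cmeasurable_comp (pair2_measurable y) mk).
Qed.

Definition kernel_apply (f : L2 mu) (y : Y) : R[i] :=
  cintegral mu (fun x => k (x, y) * f x).

Lemma kernel_applyE f y (ky : (kernel_sqint y < +oo)%E) :
  kernel_apply f y = dot f (L2_mk (kernel_section_sqint ky)).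
Proof.
rewrite dot_mkr; congr cintegral; apply/funext => x.
by rewrite /kernel_section conjcK mulrC.
Qed.

Lemma sqnorm_kernel_section y (ky : (kernel_sqint y < +oo)%E) :
  (sqnorm (L2_mk (kernel_section_sqint ky)))%:E = kernel_sqint y.
Proof.
rewrite sqnorm_integral; apply: ge0_ae_eq_integral => //.
- apply/measurable_EFinP/measurable_funX/measurable_cmod.
  exact: L2_cmeasurable.
- apply/measurable_EFinP/measurable_funX/measurable_cmod.
  exact: (cmeasurable_comp (pair2_measurable y) mk).
- by move=> x _; rewrite lee_fin sqr_ge0.
- by move=> x _; rewrite lee_fin sqr_ge0.
- apply: filterS (L2_mkE (kernel_section_sqint ky)) => x -> _.
  by rewrite /kernel_section cmod_conj.
Qed.

Lemma kernel_apply_cmeasurable f : cmeasurable (kernel_apply f).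
Proof.
have [mr mi] : cmeasurable (fun z : X * Y => k z * f z.1).
  exact: (cmeasurableM mk (cmeasurable_comp measurable_fst (L2_cmeasurable f))).
by split; [exact: measurable_Rintegral mr|exact: measurable_Rintegral mi].
Qed.

Lemma kernel_apply_bessel n (e : 'I_n -> L2 mu) : orthonormal_family e ->
  {ae nu, forall y,
    ((\sum_(i < n) cmod (kernel_apply (e i) y) ^+ 2)%:E <= kernel_sqint y)%E}.
Proof.
move=> oe; apply: filterS kernel_sqint_ae => y ky.
rewrite -(sqnorm_kernel_section ky) lee_fin.
under eq_bigr do rewrite (kernel_applyE _ ky).
exact: bessel.
Qed.

Lemma kernel_apply_cauchy_schwarz f : {ae nu, forall y,
  ((cmod (kernel_apply f y) ^+ 2)%:E <= (sqnorm f)%:E * kernel_sqint y)%E}.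
Proof.
apply: filterS kernel_sqint_ae => y ky.
rewrite -(sqnorm_kernel_section ky) -EFinM lee_fin (kernel_applyE _ ky).
exact: cauchy_schwarz.
Qed.

Lemma integral_kernel_apply f : (\int[nu]_y (cmod (kernel_apply f y) ^+ 2)%:E <=
  (sqnorm f)%:E * \int[nu]_y kernel_sqint y)%E.
Proof.
rewrite -ge0_integralZl//; last 3 first.
- exact: measurable_kernel_sqint.
- by move=> y _; exact: kernel_sqint_ge0.
- by rewrite lee_fin sqnorm_ge0.
apply: ae_ge0_le_integral => //.
- by move=> y _; rewrite lee_fin sqr_ge0.
- apply/measurable_EFinP/measurable_funX/measurable_cmod.
  exact: kernel_apply_cmeasurable.
- by move=> y _; rewrite mule_ge0 ?kernel_sqint_ge0// lee_fin sqnorm_ge0.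
- exact: measurable_funeM measurable_kernel_sqint.
- by apply: filterS (kernel_apply_cauchy_schwarz f) => y.
Qed.

Lemma kernel_apply_sqint f : kernel_apply f \in sqint nu.
Proof.
apply/sqintP; split; first exact: kernel_apply_cmeasurable.
apply: le_lt_trans (integral_kernel_apply f) _.
by rewrite lte_mul_pinfty// lee_fin sqnorm_ge0.
Qed.

Definition kernel_op (f : L2 mu) : L2 nu := L2_mk (kernel_apply_sqint f).

Lemma kernel_opE f : {ae nu, forall y, kernel_op f y = kernel_apply f y}.
Proof. exact: L2_mkE. Qed.

(** Wherever [kernel_sqint] is finite, [kernel_apply] is the inner product with one fixed section,
    and linearity is that of [dot]. *)
Lemma kernel_op_linear : linear kernel_op.
Proof.
move=> c f g; apply: L2_ext.
near=> y.
have ky : (kernel_sqint y < +oo)%E by near: y; exact: kernel_sqint_ae.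
have -> : kernel_op (c *: f + g) y = kernel_apply (c *: f + g) y.
  by near: y; exact: kernel_opE.
have -> : (c *: kernel_op f + kernel_op g : L2 nu) y =
    (c *: kernel_op f : L2 nu) y + kernel_op g y.
  by near: y; exact: L2_addE.
have -> : (c *: kernel_op f : L2 nu) y = c * kernel_op f y.
  by near: y; exact: L2_scaleE.
have -> : kernel_op f y = kernel_apply f y by near: y; exact: kernel_opE.
have -> : kernel_op g y = kernel_apply g y by near: y; exact: kernel_opE.
by rewrite !(kernel_applyE _ ky) dotDl dotZl.
Unshelve. all: by end_near. Qed.

HB.instance Definition _ :=
  GRing.isLinear.Build R[i] (L2 mu) (L2 nu) *:%R kernel_op kernel_op_linear.

Lemma sqnorm_kernel_op f :
  (sqnorm (kernel_op f))%:E = (\int[nu]_y (cmod (kernel_apply f y) ^+ 2)%:E)%E.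
Proof.
rewrite sqnorm_integral; apply: ge0_ae_eq_integral => //.
- apply/measurable_EFinP/measurable_funX/measurable_cmod.
  exact: L2_cmeasurable.
- apply/measurable_EFinP/measurable_funX/measurable_cmod.
  exact: kernel_apply_cmeasurable.
- by move=> x _; rewrite lee_fin sqr_ge0.
- by move=> x _; rewrite lee_fin sqr_ge0.
- by apply: filterS (kernel_opE f) => x -> _.
Qed.

Variable b : R.
Hypothesis b0 : 0 <= b.
Hypothesis k2b : (\int[nu]_y kernel_sqint y <= (b ^+ 2)%:E)%E.

Lemma nrm_kernel_op f : nrm (kernel_op f) <= b * nrm f.
Proof.
rewrite -(@ler_pXn2r _ 2)// ?nnegrE ?mulr_ge0 ?nrm_ge0//.
rewrite exprMn !sqr_nrm -lee_fin sqnorm_kernel_op.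
apply: le_trans (integral_kernel_apply f) _.
by rewrite mulrC EFinM lee_pmul// ?lee_fin ?sqnorm_ge0// integral_ge0// => y _;
  exact: kernel_sqint_ge0.
Qed.

Lemma sum_sqnorm_kernel_op n (e : 'I_n -> L2 mu) : orthonormal_family e ->
  \sum_(i < n) sqnorm (kernel_op (e i)) <= b ^+ 2.
Proof.
move=> oe; rewrite -lee_fin; apply: le_trans k2b.
rewrite -sumEFin; under eq_bigr do rewrite sqnorm_kernel_op.
rewrite -ge0_integral_sum//; last 2 first.
- move=> i; apply/measurable_EFinP/measurable_funX/measurable_cmod.
  exact: kernel_apply_cmeasurable.
- by move=> i y _; rewrite lee_fin sqr_ge0.
under eq_integral do rewrite sumEFin.
apply: ae_ge0_le_integral => //.
- by move=> y _; rewrite lee_fin sumr_ge0// => i _; exact: sqr_ge0.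
- apply/measurable_EFinP/measurable_sum => i.
  apply/measurable_funX/measurable_cmod.
  exact: kernel_apply_cmeasurable.
- by move=> y _; exact: kernel_sqint_ge0.
- exact: measurable_kernel_sqint.
- by apply: filterS (kernel_apply_bessel oe) => y.
Qed.

End kernel.
End kernel_operator.

(** * Taylor expansion of the phase factor *)

Section taylor_expi.
Variable R : realType.
Implicit Types (t : R) (w : R[i]).

Definition expi_taylor N t : R[i] :=
  \sum_(k < N) 'i%C ^+ k * (t ^+ k / k`!%:R)%:C.

Lemma is_derive_monomial (a : R) k t :
  is_derive t 1 (fun s : R => a * (s ^+ k.+1 / k.+1`!%:R)) (a * (t ^+ k / k`!%:R)).
Proof.
have -> : (fun s : R => a * (s ^+ k.+1 / k.+1`!%:R)) =
    (a / k.+1`!%:R) \*: ((id : R -> R) ^+ k.+1).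
  by apply/funext => s; rewrite /GRing.scale/= fctE mulrA mulrAC.
apply: is_derive_eq; rewrite /= /GRing.scale/= mulr1 factS natrM.
have k1 : k.+1%:R != 0 :> R by rewrite pnatr_eq0.
have kf : k`!%:R != 0 :> R by rewrite pnatr_eq0 -lt0n fact_gt0.
by field; rewrite kf addrC natr1 k1.
Qed.

(* The real part of the Taylor remainder turned by the phase [w]: its
   derivative is the remainder of order N - 1 for the phase [w * 'i], so that
   the complex estimate reduces to the real mean value theorem. *)
Definition expi_remainder N w t : R :=
  complex.Re w * cos t - complex.Im w * sin t -
  \sum_(k < N) complex.Re (w * 'i%C ^+ k) * (t ^+ k / k`!%:R).

Lemma expi_remainderE N w t :
  complex.Re (w * (expi t - expi_taylor N t)) = expi_remainder N w t.
Proof.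
rewrite mulrBr complexReD complexReN complexReM; congr (_ - _).
rewrite mulr_sumr complexRe_sum; apply: eq_bigr => k _.
by rewrite mulrA complexRe_mulr.
Qed.

Lemma is_derive_expi_remainder N w t :
  is_derive t 1 (expi_remainder N.+1 w) (expi_remainder N (w * 'i%C) t).
Proof.
pose h (k : 'I_N) (s : R) :=
  complex.Re (w * 'i%C ^+ k.+1) * (s ^+ k.+1 / k.+1`!%:R).
have -> : expi_remainder N.+1 w = (complex.Re w \*: cos - complex.Im w \*: sin)
    - (cst (complex.Re w) + \sum_(k < N) h k).
  apply/funext => s; rewrite /expi_remainder big_ord_recl/=.
  by rewrite !fctE fct_sumE !expr0 fact0 divr1 !mulr1.
have dh (k : 'I_N) : is_derive t 1 (h k)
    (complex.Re (w * 'i%C ^+ k.+1) * (t ^+ k / k`!%:R)).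
  exact: is_derive_monomial.
have dsum := is_derive_sum dh.
apply: is_derive_eq; rewrite add0r /expi_remainder; congr (_ - _).
  by rewrite complexReM complexImM/= /GRing.scale/=; ring.
by apply: eq_bigr => k _; rewrite exprS mulrA.
Qed.

(** Induction for all unimodular w at once, since differentiating turns w into w i. The difference
    t^(N+1)/(N+1)! - remainder vanishes at 0 and has a nonnegative derivative by induction. *)
Lemma expi_remainder_le N w t : cmod w = 1 -> 0 <= t ->
  expi_remainder N w t <= t ^+ N / N`!%:R.
Proof.
elim: N w t => [|N IH] w t w1 t0.
  rewrite expr0 divr1 /expi_remainder big_ord0 subr0.
  have := ler_Re_cmod (w * expi t).
  by rewrite cmodM w1 cmod_expi mul1r complexReM.
have [->|tn0] := eqVneq t 0.
  rewrite expr0n mul0r /expi_remainder cos0 sin0 big_ord_recl big1 => [|k _].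
    by rewrite !expr0 fact0 divr1 !mulr1 mulr0 subr0 addr0 subrr.
  by rewrite expr0n mul0r mulr0.
have tp : 0 < t by rewrite lt_def tn0.
have dH (s : R) : is_derive s 1
    (fun s : R => 1 * (s ^+ N.+1 / N.+1`!%:R) - expi_remainder N.+1 w s)
    (1 * (s ^+ N / N`!%:R) - expi_remainder N (w * 'i%C) s).
  exact: (is_deriveB (is_derive_monomial 1 N s) (is_derive_expi_remainder N w s)).
have [|c] := MVT tp (fun s _ => dH s).
  apply: derivable_within_continuous => s _.
  by have [] := dH s.
rewrite in_itv/= => /andP[c0 ct].
rewrite !mul1r expr0n mul0r sub0r opprK subr0.
have -> : expi_remainder N.+1 w 0 = 0.
  rewrite /expi_remainder cos0 sin0 big_ord_recl big1 => [|k _].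
    by rewrite !expr0 fact0 divr1 !mulr1 mulr0 subr0 addr0 subrr.
  by rewrite expr0n mul0r mulr0.
rewrite addr0 => cE; rewrite -subr_ge0 cE mulr_ge0// subr_ge0 IH ?(ltW c0)//.
by rewrite cmodM w1 mul1r /cmod/= expr0n expr1n add0r sqrtr1.
Qed.

Lemma expi_taylorN N t :
  expi (- t) - expi_taylor N (- t) = conjc (expi t - expi_taylor N t).
Proof.
rewrite conjcB conjc_sum; congr (_ - _).
  by apply: complex_eqP; rewrite /= ?cosN ?sinN.
apply: eq_bigr => k _; rewrite conjcM conjcX conjc_real.
have -> : conjc 'i%C = - 'i%C :> R[i] by apply: complex_eqP; rewrite /= ?oppr0.
rewrite (exprNn t) (exprNn 'i%C) -mulrA rmorphM rmorphXn rmorphN1.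
by rewrite mulrCA mulrA.
Qed.

(** The phase w = conj z / |z| turns the remainder z onto the positive axis, where its real part is
    its modulus. Negative t reduce to positive ones by conjugation. *)
Lemma cmod_expi_taylor_le N t :
  cmod (expi t - expi_taylor N t) <= `|t| ^+ N / N`!%:R.
Proof.
wlog t0 : t / 0 <= t => [hw|].
  have [/hw//|tn] := lerP 0 t.
  by rewrite -normrN -cmod_conj -expi_taylorN hw// oppr_ge0 ltW.
rewrite ger0_norm//; set z := expi t - _.
have [->|z0] := eqVneq z 0.
  by rewrite cmod0 divr_ge0 ?exprn_ge0 ?ler0n.
have cz : cmod z != 0 by apply: contra z0 => /eqP/cmod_eq0 ->.
pose w := conjc z * ((cmod z)^-1)%:C.
have w1 : cmod w = 1.
  by rewrite cmodM cmod_conj cmod_real ger0_norm ?invr_ge0 ?cmod_ge0// mulfV.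
apply: le_trans (expi_remainder_le N w1 t0).
rewrite -expi_remainderE -/z mulrAC (mulrC _ z) mulc_conj -rmorphM/=.
by rewrite expr2 mulfK.
Qed.

End taylor_expi.

(** * Finite rank operators *)

Section sqint_products.
Context d1 d2 (X : measurableType d1) (Y : measurableType d2) (R : realType).

Lemma sqint_bounded_mul (mu : {measure set X -> \bar R}) (f g : X -> R[i])
    (M : R) : f \in sqint mu -> cmeasurable g ->
  {ae mu, forall x, cmod (g x) <= M} -> (fun x => f x * g x) \in sqint mu.
Proof.
move=> /sqintP[mf f2] mg gM; apply/sqintP; split; first exact: cmeasurableM.
have msqr h : cmeasurable h -> measurable_fun setT (fun x : X => (cmod (h x) ^+ 2)%:E).
  by move=> mh; apply/measurable_EFinP/measurable_funX/measurable_cmod.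
apply: (@le_lt_trans _ _ (\int[mu]_x ((M ^+ 2)%:E * ((cmod (f x)) ^+ 2)%:E))%E).
  apply: ae_ge0_le_integral => //.
  - by move=> x _; rewrite lee_fin sqr_ge0.
  - exact: msqr (cmeasurableM mf mg).
  - by move=> x _; rewrite -EFinM lee_fin mulr_ge0 ?sqr_ge0.
  - by apply: measurable_funeM; exact: msqr.
  - apply: filterS gM => x gx _; rewrite -EFinM lee_fin cmodM exprMn mulrC.
    apply: ler_wpM2r; first exact: sqr_ge0.
    by rewrite ler_pXn2r// nnegrE ?cmod_ge0// (le_trans _ gx)// cmod_ge0.
rewrite ge0_integralZl//.
- by rewrite lte_mul_pinfty// lee_fin sqr_ge0.
- exact: msqr.
- by move=> x _; rewrite lee_fin sqr_ge0.
- by rewrite lee_fin sqr_ge0.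
Qed.

Lemma sqint_tensor (mu : {sigma_finite_measure set X -> \bar R})
    (nu : {sigma_finite_measure set Y -> \bar R}) (f : X -> R[i]) (g : Y -> R[i]) :
  f \in sqint mu -> g \in sqint nu ->
  (fun z : X * Y => f z.1 * g z.2) \in sqint (mu \x nu)%E.
Proof.
move=> /sqintP[mf f2] /sqintP[mg g2].
have mfg : cmeasurable (fun z : X * Y => f z.1 * g z.2).
  by apply: cmeasurableM; [exact: cmeasurable_comp measurable_fst mf|
    exact: cmeasurable_comp measurable_snd mg].
apply/sqintP; split => //.
rewrite -integral_kernel_sqint//.
rewrite (eq_integral (fun y => (\int[mu]_x ((cmod (f x)) ^+ 2)%:E) *
    ((cmod (g y)) ^+ 2)%:E)%E); last first.
  move=> y _; rewrite /kernel_sqint muleC -ge0_integralZl//.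
  - by apply: eq_integral => x _; rewrite cmodM exprMn mulrC EFinM.
  - exact/measurable_EFinP/measurable_funX/measurable_cmod.
  - by move=> x _; rewrite lee_fin sqr_ge0.
  - by rewrite lee_fin sqr_ge0.
have f_ge0 : (0 <= \int[mu]_x ((cmod (f x)) ^+ 2)%:E)%E.
  by apply: integral_ge0 => x _; rewrite lee_fin sqr_ge0.
rewrite ge0_integralZl//.
- by rewrite lte_mul_pinfty// ge0_fin_numE.
- exact/measurable_EFinP/measurable_funX/measurable_cmod.
- by move=> y _; rewrite lee_fin sqr_ge0.
Qed.

End sqint_products.

Lemma L2_lincombE d (X : measurableType d) (R : realType)
    (mu : {measure set X -> \bar R}) (J : Type) (s : seq J) (c : J -> R[i])
    (F : J -> X -> R[i]) (F2 : forall j, F j \in sqint mu) :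
  {ae mu, forall x, (\sum_(j <- s) c j *: L2_mk (F2 j) : L2 mu) x =
    \sum_(j <- s) c j * F j x}.
Proof.
elim: s => [|j s IH].
  by rewrite big_nil; apply: filterS (L2_0E mu) => x ->; rewrite big_nil.
rewrite big_cons; near=> x; rewrite big_cons.
rewrite -(_ : (\sum_(j <- s) c j *: L2_mk (F2 j) : L2 mu) x =
  \sum_(j <- s) c j * F j x); last by near: x.
rewrite -(_ : L2_mk (F2 j) x = F j x); last by near: x; exact: L2_mkE.
rewrite -(_ : (c j *: L2_mk (F2 j) : L2 mu) x = c j * L2_mk (F2 j) x); last first.
  by near: x; exact: L2_scaleE.
by near: x; exact: L2_addE.
Unshelve. all: by end_near. Qed.

Section finite_rank_operator.
Context d1 d2 (X : measurableType d1) (Y : measurableType d2) (R : realType).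
Variables (mu : {measure set X -> \bar R}) (nu : {measure set Y -> \bar R}).
Variables (J : finType) (A : J -> L2 mu) (B : J -> L2 nu).

Definition finrank_op (f : L2 mu) : L2 nu := \sum_j dot f (A j) *: B j.

Lemma finrank_op_linear : linear finrank_op.
Proof.
move=> c f g; rewrite /finrank_op scaler_sumr -big_split/=.
by apply: eq_bigr => j _; rewrite dotDl dotZl scalerDl scalerA.
Qed.

HB.instance Definition _ :=
  GRing.isLinear.Build R[i] (L2 mu) (L2 nu) *:%R finrank_op finrank_op_linear.

(** Terms sharing the same function [H i] merge into one, so the rank is bounded by the number of
    output functions and not by the number of terms. *)
Lemma finrank_op_rank (I : finType) (t : J -> I) (H : I -> L2 nu) :
  (forall j, B j = H (t j)) -> (op_rank finrank_op <= #|I|%:R%:E)%E.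
Proof.
move=> BH; apply: (op_rank_le_span (h := H)) => f.
exists (fun i => \sum_(j | t j == i) dot f (A j)).
rewrite /finrank_op (partition_big t xpredT)//=; apply: eq_bigr => i _.
by rewrite scaler_suml; apply: eq_bigr => j /eqP <-; rewrite BH.
Qed.

End finite_rank_operator.

Section separated_part.
Context d1 d2 (X : measurableType d1) (Y : measurableType d2) (R : realType).
Variables (mu : {sigma_finite_measure set X -> \bar R}).
Variables (nu : {sigma_finite_measure set Y -> \bar R}).

(** For almost every y the section of k is, as a class, the section of D plus a combination of the
    [A j]; pairing it with f gives the operator identity at y. *)
Lemma kernel_op_sub_finrank (k D : X * Y -> R[i])
    (mk : cmeasurable k) (k2 : (\int[nu]_y kernel_sqint mu k y < +oo)%E)
    (mD : cmeasurable D) (D2 : (\int[nu]_y kernel_sqint mu D y < +oo)%E)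
    (J : finType) (al : J -> X -> R[i]) (be : J -> Y -> R[i])
    (al2 : forall j, al j \in sqint mu) (be2 : forall j, be j \in sqint nu) :
  (forall x y, k (x, y) = D (x, y) + \sum_j be j y * al j x) ->
  forall f : L2 mu,
    kernel_op mk k2 f -
      finrank_op (fun j => L2_mk (sqint_conj (al2 j))) (fun j => L2_mk (be2 j)) f
    = kernel_op mD D2 f.
Proof.
move=> kD f; apply/eqP; rewrite subr_eq; apply/eqP.
pose A j := L2_mk (sqint_conj (al2 j)); pose B j := L2_mk (be2 j).
rewrite -[finrank_op _ _]/(finrank_op A B); apply: L2_ext.
near=> y.
have ky : (kernel_sqint mu k y < +oo)%E by near: y; exact: kernel_sqint_ae.
have Dy : (kernel_sqint mu D y < +oo)%E by near: y; exact: kernel_sqint_ae.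
have -> : kernel_op mk k2 f y = kernel_apply k f y by near: y; exact: kernel_opE.
have -> : (kernel_op mD D2 f + finrank_op A B f : L2 nu) y =
    kernel_op mD D2 f y + finrank_op A B f y by near: y; exact: L2_addE.
have -> : kernel_op mD D2 f y = kernel_apply D f y by near: y; exact: kernel_opE.
have -> : finrank_op A B f y = \sum_j dot f (A j) * be j y.
  by near: y; exact: L2_lincombE.
rewrite (kernel_applyE mk _ ky) (kernel_applyE mD _ Dy).
have -> : L2_mk (kernel_section_sqint mk ky) =
    L2_mk (kernel_section_sqint mD Dy) + \sum_j conjc (be j y) *: A j.
  apply: L2_ext; near=> x.
  have -> : L2_mk (kernel_section_sqint mk ky) x = kernel_section k y x.
    by near: x; exact: L2_mkE.
  have -> : (L2_mk (kernel_section_sqint mD Dy) +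
      \sum_j conjc (be j y) *: A j : L2 mu) x =
      L2_mk (kernel_section_sqint mD Dy) x +
      (\sum_j conjc (be j y) *: A j : L2 mu) x.
    by near: x; exact: L2_addE.
  have -> : L2_mk (kernel_section_sqint mD Dy) x = kernel_section D y x.
    by near: x; exact: L2_mkE.
  have -> : (\sum_j conjc (be j y) *: A j : L2 mu) x =
      \sum_j conjc (be j y) * conjc (al j x).
    by near: x; exact: L2_lincombE.
  rewrite /kernel_section kD conjcD conjc_sum; congr (_ + _).
  by apply: eq_bigr => j _; rewrite conjcM.
rewrite dotDr dot_sumr; congr (_ + _); apply: eq_bigr => j _.
by rewrite dotZr conjcK mulrC.
Unshelve. all: by end_near. Qed.

End separated_part.

(** * Counting monomials *)

Section multiindices.
Variables (r N : nat).

(** Exponents of the monomials of degree < N in r variables. The bound on the sum already forces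
    each exponent below N, so entries in ['I_N] lose nothing and make the type finite. *)
Definition multiindex : finType := {t : r.-tuple 'I_N | (\sum_(i <- t) i < N)%N}.

Variable k : 'I_N.
Variable f : {ffun 'I_k -> 'I_r}.

(** The number of occurrences of the letter l in the word f, that is, the exponent of the l-th
    variable in the associated monomial. *)
Definition fibre_size (l : 'I_r) : nat := #|[pred i | f i == l]|.

Lemma sum_fibre_size : (\sum_(l < r) fibre_size l)%N = k.
Proof.
rewrite -[RHS]card_ord -sum1_card (partition_big f xpredT)//=.
by apply: eq_bigr => l _; rewrite sum1_card.
Qed.

Lemma fibre_size_lt l : (fibre_size l < N)%N.
Proof.
apply: leq_ltn_trans (ltn_ord k).
by rewrite -[leqRHS]sum_fibre_size (bigD1 l)//= leq_addr.
Qed.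

Definition fibre_tuple : r.-tuple 'I_N :=
  [tuple Ordinal (fibre_size_lt l) | l < r].

Lemma fibre_tuple_sum : (\sum_(i <- fibre_tuple) i < N)%N.
Proof.
rewrite big_tuple; under eq_bigr do rewrite tnth_mktuple/=.
by rewrite sum_fibre_size.
Qed.

Definition fibre_multiindex : multiindex := exist _ fibre_tuple fibre_tuple_sum.

Lemma prod_fibres (A : comPzRingType) (G : 'I_r -> A) :
  \prod_(i < k) G (f i) = \prod_(l < r) G l ^+ tnth fibre_tuple l.
Proof.
rewrite (partition_big f xpredT)//=; apply: eq_bigr => l _.
rewrite tnth_mktuple/= -prodr_const.
by apply: eq_bigr => i /eqP ->.
Qed.

End multiindices.

(** Degree < N + 1 means total at most N, the stars and bars count of
    [card_partial_ord_partitions]. *)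
Lemma card_multiindex (r N : nat) : #|multiindex r N.+1| = 'C(r + N, r).
Proof.
rewrite card_sig -card_partial_ord_partitions cardsE.
by apply: eq_card => t; rewrite !inE ltnS.
Qed.

(** Expansion over words of length k instead of multi-indices, free of multinomial coefficients;
    equal monomials are merged later, when the rank is counted. *)
Lemma expr_sum_mul (A : comNzRingType) (r k : nat) (F G : 'I_r -> A) :
  (\sum_(l < r) F l * G l) ^+ k =
  \sum_(f : {ffun 'I_k -> 'I_r}) (\prod_(i < k) F (f i)) * (\prod_(i < k) G (f i)).
Proof.
rewrite -[in LHS](card_ord k) -prodr_const bigA_distr_bigA.
by apply: eq_bigr => f _; rewrite big_split.
Qed.

(** * Essential radii *)

Section essential_radius.
Context d (X : measurableType d) (R : realType).
Variables (mu : {measure set X -> \bar R}) (u : X -> R) (c : R).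

(** A finite negative essential supremum would make |u - c| negative almost everywhere, so the space
    would be null; there the essential supremum is -oo, which [fine] sends to 0. *)
Lemma ess_radius_ge0 : 0 <= ess_radius mu u c.
Proof.
rewrite leNgt /ess_radius; apply/negP => r0.
have ae0 : {ae mu, forall x, (`|u x - c|%:E <= -oo)%E}.
  apply: filterS (ess_sup_ge mu (fun x => `|u x - c|%:E)) => x.
  move: r0; case: ess_sup => [s s0|/=|/=]; rewrite ?ltxx// lee_fin => us.
  by have := le_lt_trans us s0; rewrite normr_lt0.
have /ess_supP := ae0; rewrite leeNy_eq => /eqP E.
by move: r0; rewrite E/= ltxx.
Qed.

Hypothesis u_fin : (ess_sup mu (fun x => `|u x - c|%:E) < +oo)%E.

Lemma ess_radiusP : {ae mu, forall x, `|u x - c| <= ess_radius mu u c}.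
Proof.
rewrite /ess_radius; move: u_fin (ess_sup_ge mu (fun x => `|u x - c|%:E)).
by case: ess_sup => [s| |]// _; apply: filterS => x.
Qed.

End essential_radius.

Lemma cmod_prod (R : realType) (I : Type) (s : seq I) (P : pred I)
    (F : I -> R[i]) :
  cmod (\prod_(i <- s | P i) F i) = \prod_(i <- s | P i) cmod (F i).
Proof. by elim/big_rec2: _ => [|i x z _ <-]; rewrite ?cmod1 ?cmodM. Qed.

Lemma ae_cmod_prod_le d (X : measurableType d) (R : realType)
    (mu : {measure set X -> \bar R}) (I : finType) (g : I -> X -> R[i])
    (M : I -> R) : (forall i, {ae mu, forall x, cmod (g i x) <= M i}) ->
  {ae mu, forall x, cmod (\prod_i g i x) <= \prod_i M i}.
Proof.
move=> gM; have : {ae mu, forall x i, cmod (g i x) <= M i}.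
  exact: filter_forall.
apply: filterS => x gMx.
by rewrite cmod_prod; apply: ler_prod => i _; rewrite cmod_ge0 gMx.
Qed.

Lemma L2normE d (X : measurableType d) (R : realType)
    (mu : {measure set X -> \bar R}) (f : X -> R[i]) : f \in sqint mu ->
  exists2 c : R, 0 <= c & L2norm mu f = c%:E /\
    (\int[mu]_x ((cmod (f x)) ^+ 2)%:E)%E = (c ^+ 2)%:E.
Proof.
move=> f2; have [mf f2y] := (sqintP mu f).1 f2.
exists (nrm (L2_mk f2)); first exact: nrm_ge0.
have E : (\int[mu]_x ((cmod (f x)) ^+ 2)%:E)%E = (sqnorm (L2_mk f2))%:E.
  rewrite sqnorm_integral; apply: ge0_ae_eq_integral => //.
  - exact/measurable_EFinP/measurable_funX/measurable_cmod.
  - by apply/measurable_EFinP/measurable_funX/measurable_cmod/L2_cmeasurable.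
  - by move=> x _; rewrite lee_fin sqr_ge0.
  - by move=> x _; rewrite lee_fin sqr_ge0.
  - by apply: filterS (L2_mkE f2) => x ->.
rewrite sqr_nrm; split => //.
rewrite /L2norm unlock (eq_integral (fun x => ((cmod (f x)) ^+ 2)%:E)); last first.
  by move=> x _; rewrite abse_EFin poweR_EFin ger0_norm ?cmod_ge0//
    powR_mulrn ?cmod_ge0.
by rewrite E poweR_EFin powR12_sqrt// sqnorm_ge0.
Qed.

(** * The oscillatory kernel *)

Section separated_phase.
Context (R : realType) (dX dY : measure_display)
  (X : measurableType dX) (Y : measurableType dY)
  (mu : {sigma_finite_measure set X -> \bar R})
  (nu : {sigma_finite_measure set Y -> \bar R})
  (p r : nat) (wX : X -> R[i]) (a : 'I_p -> X -> R[i])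
  (wY : Y -> R[i]) (b : 'I_p -> Y -> R[i]).
Hypotheses (wXa_L2 : forall q, (fun x => wX x * a q x) \in sqint mu)
  (wYb_L2 : forall q, (fun y => wY y * b q y) \in sqint nu).
Context (phi : X -> R) (psi : Y -> R)
  (Xl : 'I_r -> X -> R) (Yl : 'I_r -> Y -> R).
Hypotheses (mphi : measurable_fun setT phi) (mpsi : measurable_fun setT psi)
  (mXl : forall l, measurable_fun setT (Xl l))
  (mYl : forall l, measurable_fun setT (Yl l)).
Context (xi eta : 'I_r -> R).
Hypotheses
  (R_fin : forall l, (ess_sup mu (fun x => `|Xl l x - xi l|%:E) < +oo)%E)
  (S_fin : forall l, (ess_sup nu (fun y => `|Yl l y - eta l|%:E) < +oo)%E).

Let Xc l x := Xl l x - xi l.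
Let Yc l y := Yl l y - eta l.
Let rX l := ess_radius mu (Xl l) (xi l).
Let rY l := ess_radius nu (Yl l) (eta l).
Let zeta : R := \sum_(l < r) rX l * rY l.

Definition interaction (x : X) (y : Y) : R := \sum_(l < r) Xc l x * Yc l y.

(* The cross terms of the recentered interaction are absorbed in the
   one-variable phases, so that only [interaction] gets Taylor expanded. *)
Definition phaseX (x : X) : R := phi x + \sum_(l < r) Xl l x * eta l.
Definition phaseY (y : Y) : R := psi y + \sum_(l < r) xi l * Yc l y.

Lemma phaseE x y :
  phase phi psi Xl Yl x y = phaseX x + phaseY y + interaction x y.
Proof.
rewrite /phase /phaseX /phaseY /interaction.
have -> : \sum_(l < r) Xl l x * Yl l y = \sum_(l < r) Xl l x * eta l +
    \sum_(l < r) xi l * Yc l y + \sum_(l < r) Xc l x * Yc l y.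
  by rewrite -!big_split/=; apply: eq_bigr => l _; rewrite /Xc /Yc; ring.
ring.
Qed.

Lemma measurable_Xc l : measurable_fun setT (Xc l).
Proof. exact: measurable_funB. Qed.

Lemma measurable_Yc l : measurable_fun setT (Yc l).
Proof. exact: measurable_funB. Qed.

Lemma measurable_phaseX : measurable_fun setT phaseX.
Proof.
apply: measurable_funD => //; apply: measurable_sum => l.
exact: measurable_funM.
Qed.

Lemma measurable_phaseY : measurable_fun setT phaseY.
Proof.
apply: measurable_funD => //; apply: measurable_sum => l.
by apply: measurable_funM => //; exact: measurable_Yc.
Qed.

Lemma measurable_interaction :
  measurable_fun setT (fun z : X * Y => interaction z.1 z.2).
Proof.
apply: measurable_sum => l; apply: measurable_funM.
  exact: measurableT_comp (measurable_Xc l) measurable_fst.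
exact: measurableT_comp (measurable_Yc l) measurable_snd.
Qed.

Definition amp_kernel (z : X * Y) : R[i] :=
  wX z.1 * wY z.2 * amplitude a b z.1 z.2.

Lemma amp_kernel_sqint : amp_kernel \in sqint (mu \x nu)%E.
Proof.
have -> : amp_kernel = \sum_(q < p)
    (fun z : X * Y => (wX z.1 * a q z.1) * (wY z.2 * b q z.2)).
  apply/funext => z; rewrite fct_sumE /amp_kernel mulr_sumr.
  by apply: eq_bigr => q _; rewrite mulrACA.
apply: rpred_sum => q _.
exact: sqint_tensor (wXa_L2 q) (wYb_L2 q).
Qed.

Definition osc_kernel (z : X * Y) : R[i] :=
  amp_kernel z * expi (phase phi psi Xl Yl z.1 z.2).

Definition rem_kernel N (z : X * Y) : R[i] :=
  amp_kernel z * (expi (phaseX z.1 + phaseY z.2) *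
    (expi (interaction z.1 z.2) - expi_taylor N (interaction z.1 z.2))).

(** The Taylor polynomial of order 0 is empty, so K is the operator of the remainder kernel at N = 0
    and inherits its estimates. *)
Lemma rem_kernel0 : rem_kernel 0 = osc_kernel.
Proof.
apply/funext => z; rewrite /rem_kernel /osc_kernel /expi_taylor big_ord0 subr0.
by rewrite -expiD phaseE.
Qed.

Lemma rem_kernel_cmeasurable N : cmeasurable (rem_kernel N).
Proof.
have [mamp _] := (sqintP _ _).1 amp_kernel_sqint.
apply: cmeasurableM => //; apply: cmeasurableM.
  apply: cmeasurable_expi; apply: measurable_funD.
    exact: measurableT_comp measurable_phaseX measurable_fst.
  exact: measurableT_comp measurable_phaseY measurable_snd.
rewrite (_ : (fun z : X * Y => _) = (fun z : X * Y =>
    expi (interaction z.1 z.2) + (-1) * expi_taylor N (interaction z.1 z.2))).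
  apply: cmeasurableD.
    exact: cmeasurable_expi measurable_interaction.
  apply: cmeasurableM; first exact: cmeasurable_cst.
  apply: cmeasurable_sum => k; apply: cmeasurableM; first exact: cmeasurable_cst.
  apply: cmeasurable_real; apply: measurable_funM => //.
  by apply: measurable_funX; exact: measurable_interaction.
by apply/funext => z; rewrite mulN1r.
Qed.

Lemma zeta_ge0 : 0 <= zeta.
Proof. by apply: sumr_ge0 => l _; rewrite mulr_ge0// ess_radius_ge0. Qed.

(** The nested quantifiers fit the iterated integrals in which the bound is used: the radii in y
    hold for almost every y, those in x then for almost every x. *)
Lemma interaction_le :
  {ae nu, forall y, {ae mu, forall x, `|interaction x y| <= zeta}}.
Proof.
have : {ae nu, forall y l, `|Yc l y| <= rY l}.
  by apply: filter_forall => l; exact: ess_radiusP.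
apply: filterS => y Yy.
have : {ae mu, forall x l, `|Xc l x| <= rX l}.
  by apply: filter_forall => l; exact: ess_radiusP.
apply: filterS => x Xx; apply: le_trans (ler_norm_sum _ _ _) _.
by apply: ler_sum => l _; rewrite normrM ler_pM.
Qed.

Lemma integral_rem_kernel_le N (c : R) : 0 <= c ->
  (\int[mu \x nu]_z (cmod (amp_kernel z) ^+ 2)%:E)%E = (c ^+ 2)%:E ->
  (\int[nu]_y kernel_sqint mu (rem_kernel N) y <=
    ((c * (zeta ^+ N / N`!%:R)) ^+ 2)%:E)%E.
Proof.
move=> c0 cE; set t := zeta ^+ N / _.
have [mamp _] := (sqintP _ _).1 amp_kernel_sqint.
have mrem := rem_kernel_cmeasurable N.
rewrite exprMn mulrC EFinM -cE -integral_kernel_sqint// -ge0_integralZl//.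
- apply: ae_ge0_le_integral => //.
  + by move=> y _; exact: kernel_sqint_ge0.
  + exact: measurable_kernel_sqint.
  + by move=> y _; rewrite mule_ge0 ?kernel_sqint_ge0// lee_fin sqr_ge0.
  + by apply: measurable_funeM; exact: measurable_kernel_sqint.
  apply: filterS interaction_le => y xy _.
  have msec k : cmeasurable k ->
      measurable_fun setT (fun x : X => (cmod (k (x, y)) ^+ 2)%:E).
    move=> mk; apply/measurable_EFinP/measurable_funX/measurable_cmod.
    exact: (cmeasurable_comp (pair2_measurable y) mk).
  rewrite /kernel_sqint -ge0_integralZl//.
  + apply: ae_ge0_le_integral => //.
    * by move=> x _; rewrite lee_fin sqr_ge0.
    * exact: msec.
    * by move=> x _; rewrite -EFinM lee_fin mulr_ge0 ?sqr_ge0.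
    * by apply: measurable_funeM; exact: msec.
    apply: filterS xy => x ux _; rewrite -EFinM lee_fin /rem_kernel cmodM exprMn.
    rewrite mulrC; apply: ler_wpM2r; first exact: sqr_ge0.
    rewrite cmodM cmod_expi mul1r ler_pXn2r ?nnegrE ?cmod_ge0//; last first.
      by rewrite divr_ge0 ?exprn_ge0 ?zeta_ge0 ?ler0n.
    apply: le_trans (cmod_expi_taylor_le _ _) _.
    rewrite ler_wpM2r ?invr_ge0 ?ler0n// lerXn2r ?nnegrE ?normr_ge0//.
    exact: zeta_ge0.
  + exact: msec.
  + by move=> x _; rewrite lee_fin sqr_ge0.
  + by rewrite lee_fin sqr_ge0.
- exact: measurable_kernel_sqint.
- by move=> y _; exact: kernel_sqint_ge0.
- by rewrite lee_fin sqr_ge0.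
Qed.

(** * Expansion of the truncated kernel into separated terms *)

Section separated_terms.
Variable N : nat.

(** A summand q of the amplitude, a degree k < N and a word of length k. All Taylor coefficients go
    to [termX], so that the factor in y depends on the word only through its multi-index. *)
Definition term_index : finType :=
  ('I_p * {k : 'I_N & {ffun 'I_k -> 'I_r}})%type.

Definition term_coef k : R[i] := 'i%C ^+ k * (k`!%:R^-1)%:C.

Definition termX (j : term_index) (x : X) : R[i] :=
  wX x * a j.1 x * (expi (phaseX x) * term_coef (tag j.2) *
    \prod_(i < tag j.2) (Xc (tagged j.2 i) x)%:C).

Definition monomialY (i : 'I_p * multiindex r N) (y : Y) : R[i] :=
  wY y * b i.1 y * (expi (phaseY y) *
    \prod_(l < r) (Yc l y)%:C ^+ tnth (val i.2) l).

Definition term_multiindex (j : term_index) : 'I_p * multiindex r N :=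
  (j.1, fibre_multiindex (tagged j.2)).

Lemma termX_sqint j : termX j \in sqint mu.
Proof.
apply: (sqint_bounded_mul
  (M := cmod (term_coef (tag j.2)) * \prod_(i < tag j.2) rX (tagged j.2 i)) (wXa_L2 j.1)).
  apply: cmeasurableM; first apply: cmeasurableM.
  - exact: cmeasurable_expi measurable_phaseX.
  - exact: cmeasurable_cst.
  - apply: cmeasurable_prod => i; apply: cmeasurable_real.
    exact: measurable_Xc.
have : {ae mu, forall x, cmod (\prod_(i < tag j.2) (Xc (tagged j.2 i) x)%:C) <=
    \prod_(i < tag j.2) rX (tagged j.2 i)}.
  apply: ae_cmod_prod_le => i.
  apply: filterS (ess_radiusP (R_fin (tagged j.2 i))) => x.
  by rewrite cmod_real.
apply: filterS => x Xx; rewrite cmodM (cmodM (expi _)) cmod_expi mul1r.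
by apply: ler_wpM2l => //; exact: cmod_ge0.
Qed.

Lemma monomialY_sqint i : monomialY i \in sqint nu.
Proof.
apply: (sqint_bounded_mul
  (M := \prod_(l < r) rY l ^+ tnth (val i.2) l) (wYb_L2 i.1)).
  apply: cmeasurableM; first exact: cmeasurable_expi measurable_phaseY.
  apply: cmeasurable_prod => l; rewrite (_ : (fun y => _) =
    (fun y => ((Yc l y) ^+ tnth (val i.2) l)%:C)).
    apply: cmeasurable_real; apply: measurable_funX; exact: measurable_Yc.
  by apply/funext => y; rewrite rmorphXn.
have : {ae nu, forall y, cmod (\prod_(l < r) (Yc l y)%:C ^+ tnth (val i.2) l) <=
    \prod_(l < r) rY l ^+ tnth (val i.2) l}.
  apply: ae_cmod_prod_le => l; apply: filterS (ess_radiusP (S_fin l)) => y Yy.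
  by rewrite cmodX cmod_real lerXn2r ?nnegrE ?normr_ge0 ?ess_radius_ge0.
by apply: filterS => y Yy; rewrite cmodM cmod_expi mul1r.
Qed.

Lemma osc_kernelE x y : osc_kernel (x, y) = rem_kernel N (x, y) +
  \sum_(j : term_index) monomialY (term_multiindex j) y * termX j x.
Proof.
have powE (k : nat) : (interaction x y ^+ k)%:C =
    \sum_(f : {ffun 'I_k -> 'I_r})
      (\prod_(i < k) (Xc (f i) x)%:C) * \prod_(i < k) (Yc (f i) y)%:C :> R[i].
  transitivity ((\sum_(l < r) (Xc l x)%:C * (Yc l y)%:C) ^+ k : R[i]);
    last exact: expr_sum_mul.
  rewrite rmorphXn rmorph_sum; congr (_ ^+ _).
  by apply: eq_bigr => l _; rewrite rmorphM.
pose G (j : term_index) := monomialY (term_multiindex j) y * termX j x.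
have -> : \sum_j G j = \sum_(q < p) \sum_(k < N)
    \sum_(f : {ffun 'I_k -> 'I_r}) G (q, Tagged (fun k : 'I_N => {ffun 'I_k -> 'I_r}) f).
  under [RHS]eq_bigr do rewrite sig_big_dep/=.
  by rewrite pair_bigA/=; apply: eq_bigr => -[q [k f]].
have -> : osc_kernel (x, y) = rem_kernel N (x, y) +
    amp_kernel (x, y) * (expi (phaseX x + phaseY y) *
      expi_taylor N (interaction x y)).
  by rewrite /rem_kernel /osc_kernel phaseE (expiD (_ + _)) /=; ring.
congr (_ + _); rewrite /amp_kernel /amplitude /= mulr_sumr mulr_suml.
apply: eq_bigr => q _; rewrite !mulr_sumr; apply: eq_bigr => k _.
rewrite real_complexM powE expiD mulr_suml !mulr_sumr; apply: eq_bigr => f _.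
rewrite /G /monomialY /termX /= /term_coef -prod_fibres; ring.
Qed.

End separated_terms.
End separated_phase.

(** * Identification of the operator, and existence of the threshold order *)

(** The kernel carries w_Y(y) inside the integral. Where w_Y(y) is nonzero, division by it keeps the
    integrand integrable and the factor comes out; where it vanishes, both sides are 0 whatever the
    remaining integral is. *)
Lemma oscillatory_integralE (R : realType) (dX dY : measure_display)
  (X : measurableType dX) (Y : measurableType dY)
  (mu : {sigma_finite_measure set X -> \bar R})
  (wX : X -> R[i]) (wY : Y -> R[i]) (A : X -> Y -> R[i]) (Phi : X -> Y -> R)
  (k : X * Y -> R[i]) (mk : cmeasurable k) (f : L2 mu) (y : Y) :
  (forall x, k (x, y) = wX x * wY y * A x y * expi (Phi x y)) ->
  (kernel_sqint mu k y < +oo)%E ->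
  kernel_apply k f y = oscillatory_integral mu wX wY A Phi f y.
Proof.
move=> kE ky; rewrite /oscillatory_integral.
have [w0|w0] := eqVneq (wY y) 0.
  rewrite w0 mul0r /kernel_apply /cintegral.
  have k0 x : k (x, y) * f x = 0 by rewrite kE w0 mulr0 !mul0r.
  by apply: complex_eqP => /=; under eq_Rintegral do rewrite k0/=;
    rewrite /Rintegral integral0.
have kfi : cintegrable mu (fun x => k (x, y) * f x).
  apply: cintegrable_mul (L2_sqint f); apply/sqintP; split=> //.
  exact: (cmeasurable_comp (pair2_measurable y) mk).
rewrite (_ : (fun x => _ * f x) = fun x => (wY y)^-1 * (k (x, y) * f x)).
  by rewrite cintegralZ// mulrA mulfV// mul1r.
by apply/funext => x; rewrite kE; field.
Qed.

Lemma exists_least (P : nat -> Prop) : (exists n, P n) -> exists n, is_least P n.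
Proof.
move=> [n Pn]; have exP : exists n, `[< P n >] by exists n; apply/asboolP.
exists (ex_minn exP); case: ex_minnP => m /asboolP Pm le_m; split => // k Pk.
by apply: le_m; apply/asboolP.
Qed.

Lemma exp_coeff_small (R : realType) (c z e : R) : 0 <= c -> 0 < e ->
  exists N : nat, c * (z ^+ N / N`!%:R) <= e.
Proof.
move=> c0 e0.
have : (fun N => c * exp_coeff z N) @ \oo --> c * 0.
  by apply: cvgMr; exact: cvg_exp_coeff.
rewrite mulr0 => /cvgrPdist_lt/(_ _ e0)[N _ /(_ N (leqnn N))]/=.
rewrite sub0r normrN => h; exists N; apply: le_trans (ler_norm _) _.
exact: ltW.
Qed.

Theorem theorem7p1 (R : realType) (dX dY : measure_display)
  (X : measurableType dX) (Y : measurableType dY)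
  (mu : {sigma_finite_measure set X -> \bar R})
  (nu : {sigma_finite_measure set Y -> \bar R})
  (p r : nat) (p_ge1 : (1 <= p)%N) (r_ge1 : (1 <= r)%N)
  (wX : X -> R[i]) (a : 'I_p -> X -> R[i])
  (wY : Y -> R[i]) (b : 'I_p -> Y -> R[i])
  (mwX : cmeasurable wX) (ma : forall q, cmeasurable (a q))
  (mwY : cmeasurable wY) (mb : forall q, cmeasurable (b q))
  (wXa_L2 : forall q, (fun x => wX x * a q x) \in sqint mu)
  (wYb_L2 : forall q, (fun y => wY y * b q y) \in sqint nu)
  (phi : X -> R) (psi : Y -> R)
  (Xl : 'I_r -> X -> R) (Yl : 'I_r -> Y -> R)
  (mphi : measurable_fun setT phi) (mpsi : measurable_fun setT psi)
  (mXl : forall l, measurable_fun setT (Xl l))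
  (mYl : forall l, measurable_fun setT (Yl l))
  (xi eta : 'I_r -> R)
  (R_fin : forall l, (ess_sup mu (fun x => `|Xl l x - xi l|%:E) < +oo)%E)
  (S_fin : forall l, (ess_sup nu (fun y => `|Yl l y - eta l|%:E) < +oo)%E) :
  let amp := amplitude a b in
  let Phi := phase phi psi Xl Yl in
  let zeta : R :=
    \sum_(l < r) ess_radius mu (Xl l) (xi l) * ess_radius nu (Yl l) (eta l) in
  let C : \bar R := L2norm (mu \x nu)%E
    (fun z : X * Y => wX z.1 * wY z.2 * amp z.1 z.2) in
  let bound (N : nat) : \bar R := (C * (zeta ^+ N / N`!%:R)%:E)%E in
  exists K : {linear L2 mu -> L2 nu},
    [/\ forall f : L2 mu, {ae nu, forall y,
          (K f : L2 nu) y = oscillatory_integral mu wX wY amp Phi f y},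
        hilbert_schmidt K,
        forall N : nat, exists KN : {linear L2 mu -> L2 nu},
          (op_rank KN <= (rank_bound p r N)%:R%:E)%E /\
          forall B : set (L2 mu), orthonormal_basis B ->
            (opnorm (fun f => K f - KN f)%R
               <= hs_norm B (fun f => K f - KN f)%R <= bound N)%E,
        forall N : nat,
          (singular_value K (rank_bound p r N).+1 <= bound N)%E &
        (opnorm K <= 1)%E ->
          forall eps : R, 0 < eps < 2^-1 ->
          exists2 Nan : nat,
            is_least (fun N => (bound N <= (Num.sqrt eps)%:E)%E) Nan &
            (Lambda eps (adjoint K \o K)
               <= (rank_bound p r Nan)%:R%:E)%E].
Proof.
move=> amp Phi zeta C bound.
have AE := amp_kernel_sqint wXa_L2 wYb_L2.
have [c c0 [CE cE]] := L2normE AE.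
have zeta0 : 0 <= zeta by exact: zeta_ge0.
(* Here [zeta ^+ 0] is 1 even when zeta = 0, so t 0 = C as the convention for N = 0 demands. *)
pose t (N : nat) : R := c * (zeta ^+ N / N`!%:R).
have t0 N : 0 <= t N by rewrite mulr_ge0// divr_ge0 ?exprn_ge0.
have boundE N : bound N = (t N)%:E by rewrite /bound /C CE -EFinM.
pose D := rem_kernel wX a wY b phi psi Xl Yl xi eta.
have mD N : cmeasurable (D N) by exact: rem_kernel_cmeasurable.
have D2 N : (\int[nu]_y kernel_sqint mu (D N) y <= ((t N) ^+ 2)%:E)%E.
  exact: integral_rem_kernel_le.
have D2y N : (\int[nu]_y kernel_sqint mu (D N) y < +oo)%E.
  by apply: le_lt_trans (D2 N) _; rewrite ltry.
pose KD N : {linear L2 mu -> L2 nu} := kernel_op (mD N) (D2y N).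
pose K := KD 0%N.
have KD_nrm N f : nrm (KD N f) <= t N * nrm f by exact: nrm_kernel_op.
have KD_hs N B : orthonormal_basis B -> (hs_norm B (KD N) <= (t N)%:E)%E.
  by move=> oB; apply: hs_norm_le => // n e; exact: sum_sqnorm_kernel_op.
have finrank N : exists2 KN : {linear L2 mu -> L2 nu},
    (op_rank KN <= (rank_bound p r N)%:R%:E)%E &
    forall f, K f - KN f = KD N f.
  have hX (j : term_index p r N) : termX wX a phi Xl xi eta j \in sqint mu.
    exact: termX_sqint.
  have hY (i : 'I_p * multiindex r N) : monomialY wY b psi Yl xi eta i \in sqint nu.
    exact: monomialY_sqint.
  exists (finrank_op (fun j => L2_mk (sqint_conj (hX j)))
    (fun j => L2_mk (hY (term_multiindex j)))).
    apply: le_trans (finrank_op_rank _ (t := @term_multiindex p r N)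
      (H := fun i => L2_mk (hY i)) _) _ => //.
    rewrite lee_fin ler_nat card_prod card_ord.
    (* For order N + 1 the count is p * C(N + r, r). At order 0 no degree is below 0, so there are
       no multi-indices and the rank bound is 0. *)
    case: N {hX hY} => [|N]; last first.
      by rewrite card_multiindex /rank_bound addSn subn1 addnC.
    rewrite [X in (_ * X)%N](_ : _ = 0%N) ?muln0//.
    by apply: eq_card0 => -[].
  move=> f; apply: kernel_op_sub_finrank => x y.
  by rewrite /D rem_kernel0; exact: osc_kernelE.
exists K; split.
- move=> f; near=> y.
  have -> : (K f : L2 nu) y = kernel_apply (D 0%N) f y by near: y; exact: kernel_opE.
  apply: oscillatory_integralE => [|x|].
  + exact: mD.
  + by rewrite /D rem_kernel0.
  + by near: y; exact: kernel_sqint_ae.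
- split; first by apply: le_lt_trans (opnorm_le (t0 0%N) (KD_nrm 0%N)) _; rewrite ltry.
  by move=> B oB; apply: le_lt_trans (KD_hs 0%N B oB) _; rewrite ltry.
- move=> N; have [KN KN_rank KKN] := finrank N; exists KN; split => // B oB.
  have -> : (fun f => K f - KN f) = KD N by apply/funext.
  rewrite boundE KD_hs// andbT.
  exact: opnorm_le_hs_norm (t0 N) (KD_nrm N) oB.
- move=> N; have [KN KN_rank KKN] := finrank N; rewrite boundE.
  by apply: (singular_value_le KN_rank) => // f; rewrite KKN.
- move=> _ eps /andP[eps0 _].
  have exN : exists N, (bound N <= (Num.sqrt eps)%:E)%E.
    have s0 : 0 < Num.sqrt eps by rewrite sqrtr_gt0.
    have [N tN] := exp_coeff_small zeta c0 s0.
    by exists N; rewrite boundE lee_fin.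
  have [N Nleast] := exists_least exN; exists N => //.
  have [KN KN_rank KKN] := finrank N.
  (* The threshold is sqrt eps because <S g, g> = |K g|^2 carries the square of the error bound. *)
  apply: (Lambda_le KN_rank (t0 N)) => [f|]; first by rewrite KKN.
  move: Nleast => [+ _]; rewrite boundE lee_fin => tN.
  rewrite -[leRHS]sqr_sqrtr ?(ltW eps0)//.
  by rewrite ler_pXn2r// nnegrE ?sqrtr_ge0.
Unshelve. all: by end_near. Qed.
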